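(* Let $\mathbb{D}_Q\subset\mathbb{M}^d$ be a nc operator ball, and let $(\mathcal{A},\tau)$ be either $A(\mathbb{D}_Q)$ with the norm topology or $H^\infty(\mathbb{D}_Q)$ with the bounded-pointwise topology. (1) If $\mathcal{J}\triangleleft\mathbb{C}\langle Z\rangle$ is a homogeneous ideal, then $I_p(V(\mathcal{J}))=\mathcal{J}$. (2) If $\mathcal{J}\triangleleft\mathcal{A}$ is a homogeneous ideal, then $I(V(\mathcal{J}))=\overline{\mathcal{J}}^{\tau}$.
   Context: $M_n^d$ is the set of $d$-tuples of complex $n\times n$ matrices ($M_n=M_n^1$); $\mathbb{M}^d=\sqcup_{n\ge1}M_n^d$; for $\Omega\subseteq\mathbb{M}^d$, $\Omega(n)=\Omega\cap M_n^d$. A nc function $f:\Omega\to\mathbb{M}^1$ on a set $\Omega$ closed under direct sums is a graded map ($X\in\Omega(n)\Rightarrow f(X)\in M_n$) with $f(X\oplus Y)=f(X)\oplus f(Y)$ and $f(S^{-1}XS)=S^{-1}f(X)S$ whenever $S\in GL_n$ and $X,S^{-1}XS\in\Omega(n)$. $\mathbb{C}\langle Z\rangle=\mathbb{C}\langle Z_1,\dots,Z_d\rangle$ is the algebra of free nc polynomials. NC operator ball ($d\in\mathbb{N}$): given Hilbert spaces $\mathcal{R},\mathcal{S}$ and linearly independent $Q_1,\dots,Q_d\in\mathcal{L}(\mathcal{R},\mathcal{S})$, put $Q(X)=\sum_jQ_j\otimes X_j$ for $X\in\mathbb{M}^d$ and $\mathbb{D}_Q=\{X\in\mathbb{M}^d:\|Q(X)\|<1\}$.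 $H^\infty(\mathbb{D}_Q)$ is the algebra of bounded nc functions $\mathbb{D}_Q\to\mathbb{M}^1$ with the sup norm $\|f\|=\sup_{X\in\mathbb{D}_Q}\|f(X)\|$; $A(\mathbb{D}_Q)$ is the norm closure of $\mathbb{C}\langle Z\rangle$ in it. The bounded-pointwise topology on $H^\infty(\mathbb{D}_Q)$ is the weakest topology in which a bounded net $F^{(\kappa)}$ converges to $F$ if and only if $F^{(\kappa)}(X)\to F(X)$ in norm for every $X\in\mathbb{D}_Q$. Every $F\in H^\infty(\mathbb{D}_Q)$ has a power series $F(X)=\sum_{\alpha\in\mathbb{F}_d^+}c_\alpha X^\alpha$ on $\mathbb{D}_Q$ ($\mathbb{F}_d^+$ the free monoid on $d$ letters); its $k$-th homogeneous part is $F_k=\sum_{|\alpha|=k}c_\alpha Z^\alpha$. A (two-sided) ideal $\mathcal{J}$ of $\mathcal{A}$ or of $\mathbb{C}\langle Z\rangle$ is homogeneous if $F\in\mathcal{J}$ implies $F_k\in\mathcal{J}$ for all $k\ge0$. $V(\mathcal{J})=\{X\in\mathbb{D}_Q:F(X)=0\ \forall F\in\mathcal{J}\}$. For $\mathfrak{V}\subseteq\mathbb{D}_Q$, $I(\mathfrak{V})=\{F\in\mathcal{A}:F|_{\mathfrak{V}}=0\}$ and $I_p(\mathfrak{V})=\{p\in\mathbb{C}\langle Z\rangle:p|_{\mathfrak{V}}=0\}$.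
   Formalization: The bounded-pointwise topology is taken to be the finest, not the weakest, topology in which bounded nets converge exactly when they converge pointwise; in the literal weakest one every nonzero ideal is dense, so part (2) for H^∞ would fail. *)

(* Defs.v *)
From HB Require Import structures.
From mathcomp Require Import all_boot all_order all_algebra.
From mathcomp Require Import complex finmap.
From mathcomp Require Import all_classical all_reals all_analysis.
From mathcomp Require Import ring lra.
(* [monalg] supplies the free algebra; its notations clash with those of
   MathComp-Analysis, so they are not imported. *)
From mathcomp.multinomials Require Import (canonicals, coercions) monalg.

Set Implicit Arguments.
Unset Strict Implicit.
Unset Printing Implicit Defensive.

Import Order.TTheory GRing.Theory Num.Theory.
Import numFieldNormedType.Exports.
Local Open Scope classical_set_scope.
Local Open Scope ring_scope.

(* The complex numbers, typed so that the topology that MathComp-Analysis puts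
   on every numFieldType is found (it is not found on [R[i]] itself). *)
Definition Cplx (R : realType) : numClosedFieldType := R[i].

(* Norms of modules over [Cplx R] take values in [Cplx R]; this is the same
   norm as a real number. *)
Definition rnorm (R : realType) (V : normedZmodType (Cplx R)) (x : V) : R :=
  complex.Re (`|x| : R[i]).

(* The inner product is linear in its first argument. *)
Record hilbertType (R : realType) := Hilbert {
  hilbert_sort :> completeNormedModType (Cplx R);
  hdot : {dot hilbert_sort for Num.conj};
  hnormE : forall x : hilbert_sort, `|x| ^+ 2 = hdot x x }.

Section OperatorNorm.
Variable R : realType.
Local Notation C := (Cplx R).

(* The norm of the Hilbert sum of [n] copies of [V]; when [V] is a Hilbert
   space this is the Hilbert space tensor product of [V] and C^n. *)
Definition l2norm (V : normedZmodType C) n (v : 'I_n -> V) : R :=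
  Num.sqrt (\sum_i rnorm (v i) ^+ 2).

Definition opnorm (V W : normedZmodType C) n m
    (T : ('I_n -> V) -> ('I_m -> W)) : \bar R :=
  ereal_sup [set (l2norm (T v))%:E | v in [set v : 'I_n -> V | l2norm v <= 1]].

Definition mxact n (A : 'M[C]_n) (v : 'I_n -> C) : 'I_n -> C :=
  fun i => \sum_k A i k * v k.

Definition mxnorm n (A : 'M[C]_n) : \bar R := opnorm (mxact A).

End OperatorNorm.

Section Ball.
Variables (R : realType) (d : nat) (HR HS : hilbertType R).
Variable Q : 'I_d -> {linear HR -> HS}.
Local Notation C := (Cplx R).

Definition lin_indep := forall c : 'I_d -> C,
  (forall x : HR, \sum_j c j *: Q j x = 0) -> forall j, c j = 0.

(* [\sum_j Q j (x) X j] as an operator from [HR (x) C^n] to [HS (x) C^n],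
   these spaces being identified with [HR^n] and [HS^n]. *)
Definition Qop n (X : 'I_d -> 'M[C]_n) (v : 'I_n -> HR) : 'I_n -> HS :=
  fun i => \sum_j \sum_k X j i k *: Q j (v k).

(* Level [n] of everything below consists of matrices of size [n.+1], so that
   the sizes are exactly the positive integers. *)
Definition ncball n : set ('I_d -> 'M[C]_n.+1) :=
  [set X | (opnorm (Qop X) < 1)%E].
Arguments ncball n _ : clear implicits.

Definition gmap : Type := forall n, ncball n -> 'M[C]_n.+1.

Definition dsum n m (A : 'M[C]_n.+1) (B : 'M[C]_m.+1) :
    'M[C]_((n + m.+1).+1) := (block_mx A 0 0 B : 'M[C]_(n.+1 + m.+1)).

Definition is_nc (f : gmap) : Prop :=
  (forall n m (X : ncball n) (Y : ncball m) (Z : ncball (n + m.+1)%N),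
     val Z = (fun j => dsum (val X j) (val Y j)) ->
     f _ Z = dsum (f _ X) (f _ Y)) /\
  (forall n (S : 'M[C]_n.+1) (X Y : ncball n), S \in unitmx ->
     val Y = (fun j => invmx S *m val X j *m S) ->
     f _ Y = invmx S *m f _ X *m S).

Definition supnorm (f : gmap) : \bar R :=
  ereal_sup (\bigcup_n range (fun X : ncball n => mxnorm (f n X))).

End Ball.
Arguments ncball {R d HR HS} Q n _.
Arguments gmap {R d HR HS} Q.

Section RealNorm.
Variable R : realType.
Local Notation C := (Cplx R).
Variable V : normedZmodType C.
Implicit Types x y : V.

Lemma rnormE x : `|x| = (rnorm x)%:C%C :> R[i].
Proof.
have := normr_ge0 x; rewrite /rnorm; case: (`|x| : R[i]) => a b.
by rewrite lecE /= => /andP[/eqP -> _].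
Qed.

Lemma rnorm_ge0 x : 0 <= rnorm x.
Proof. by have := normr_ge0 x; rewrite rnormE lecE => /andP[]. Qed.

Lemma rnormD x y : rnorm (x + y) <= rnorm x + rnorm y.
Proof.
by have := ler_normD x y; rewrite !rnormE -rmorphD /= lecE => /andP[].
Qed.

Lemma rnorm0 : rnorm (0 : V) = 0.
Proof. by rewrite /rnorm normr0. Qed.

Lemma rnorm_eq0 x : rnorm x = 0 -> x = 0.
Proof. by move=> x0; apply/normr0_eq0; rewrite rnormE x0. Qed.

End RealNorm.

Section RealNormC.
Variable R : realType.
Local Notation C := (Cplx R).

Lemma rnormM (a b : C) : rnorm (a * b) = rnorm a * rnorm b.
Proof.
have := normrM a b; rewrite !rnormE -rmorphM /=.
by move=> /(congr1 (@complex.Re R)).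
Qed.

End RealNormC.

Section L2.
Variable R : realType.
Local Notation C := (Cplx R).

Lemma CauchySchwarz_sum n (a b : 'I_n -> R) :
  (\sum_i a i * b i) ^+ 2 <= (\sum_i a i ^+ 2) * (\sum_i b i ^+ 2).
Proof.
set D := \sum_i _; set A := \sum_i a i ^+ 2; set B := \sum_i b i ^+ 2.
have B0 : 0 <= B by apply: sumr_ge0 => i _; exact: sqr_ge0.
have [B_eq0|B_neq0] := eqVneq B 0.
  have b0 i : b i = 0.
    apply/eqP; rewrite -sqrf_eq0; move: B_eq0 => /eqP.
    rewrite psumr_eq0 => [/allP/(_ i (mem_index_enum _)) //|? _].
    exact: sqr_ge0.
  rewrite /D big1 ?expr0n ?B_eq0 ?mulr0// => i _.
  by rewrite b0 mulr0.
have Bgt0 : 0 < B by rewrite lt_def B_neq0.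
have : 0 <= \sum_i (B * a i - D * b i) ^+ 2.
  by apply: sumr_ge0 => i _; exact: sqr_ge0.
have -> : \sum_i (B * a i - D * b i) ^+ 2 = B * (A * B - D ^+ 2).
  transitivity (\sum_i (B ^+ 2 * a i ^+ 2 - (2 * B * D) * (a i * b i)
                        + D ^+ 2 * b i ^+ 2)).
    by apply: eq_bigr => i _; ring.
  by rewrite big_split /= sumrB -!mulr_sumr -/A -/B -/D; ring.
by rewrite pmulr_rge0// subr_ge0.
Qed.

Variable V : normedZmodType C.

Lemma l2norm_ge0 n (v : 'I_n -> V) : 0 <= l2norm v.
Proof. exact: sqrtr_ge0. Qed.

Lemma sqr_l2norm n (v : 'I_n -> V) :
  l2norm v ^+ 2 = \sum_i rnorm (v i) ^+ 2.
Proof. by rewrite sqr_sqrtr// sumr_ge0// => i _; exact: sqr_ge0. Qed.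

Lemma l2norm0 n : l2norm (fun _ : 'I_n => 0 : V) = 0.
Proof.
by rewrite /l2norm big1 ?sqrtr0// => i _; rewrite rnorm0 expr0n.
Qed.

Lemma l2norm_eq0 n (v : 'I_n -> V) : l2norm v = 0 -> forall i, v i = 0.
Proof.
move=> v0 i; apply/rnorm_eq0/eqP; rewrite -sqrf_eq0.
have /eqP := sqr_l2norm v; rewrite v0 expr0n eq_sym psumr_eq0 => [|? _].
  by move=> /allP/(_ i (mem_index_enum _)).
exact: sqr_ge0.
Qed.

Lemma l2normD n (v w : 'I_n -> V) :
  l2norm (fun i => v i + w i) <= l2norm v + l2norm w.
Proof.
rewrite -(@ler_pXn2r _ 2)// ?nnegrE ?addr_ge0 ?l2norm_ge0//.
rewrite sqr_l2norm sqrrD !sqr_l2norm.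
apply: (@le_trans _ _ (\sum_i (rnorm (v i) + rnorm (w i)) ^+ 2)).
  apply: ler_sum => i _.
  by rewrite ler_pXn2r// ?nnegrE ?addr_ge0 ?rnorm_ge0// rnormD.
under eq_bigr do rewrite sqrrD.
rewrite !big_split /= lerD2r lerD2l -mulr2n lerMn2r /=.
apply: le_trans (ler_norm _) _.
rewrite -(@ler_pXn2r _ 2)// ?nnegrE ?mulr_ge0 ?l2norm_ge0//.
by rewrite real_normK ?num_real// exprMn !sqr_l2norm CauchySchwarz_sum.
Qed.

End L2.

Section MatrixNorm.
Variable R : realType.
Local Notation C := (Cplx R).

Lemma l2normZ n (a : C) (v : 'I_n -> C) :
  l2norm (fun i => a * v i) = rnorm a * l2norm v.
Proof.
apply/eqP; rewrite -(@eqrXn2 _ 2)// ?mulr_ge0 ?rnorm_ge0 ?l2norm_ge0//.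
rewrite exprMn !sqr_l2norm mulr_sumr; apply/eqP.
by apply: eq_bigr => i _; rewrite rnormM exprMn.
Qed.

Lemma rnorm_real (a : R) : 0 <= a -> rnorm ((a%:C)%C : C) = a.
Proof.
by move=> a0; rewrite /rnorm (ger0_norm (x := (a%:C)%C : C))// lecR.
Qed.

Lemma mxactD n (A B : 'M[C]_n) v :
  mxact (A + B) v = (fun i => mxact A v i + mxact B v i).
Proof.
apply/funext => i; rewrite /mxact -big_split /=.
by apply: eq_bigr => k _; rewrite mxE mulrDl.
Qed.

Lemma mxactZ n a (A : 'M[C]_n) v :
  mxact (a *: A) v = (fun i => a * mxact A v i).
Proof.
apply/funext => i; rewrite /mxact mulr_sumr.
by apply: eq_bigr => k _; rewrite mxE mulrA.
Qed.

Lemma mxact_scale n (A : 'M[C]_n) a v :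
  mxact A (fun i => a * v i) = (fun i => a * mxact A v i).
Proof.
apply/funext => i; rewrite /mxact mulr_sumr.
by apply: eq_bigr => k _; rewrite mulrCA.
Qed.

Lemma mxactM n (A B : 'M[C]_n) v : mxact (A *m B) v = mxact A (mxact B v).
Proof.
apply/funext => i; rewrite /mxact.
under [RHS]eq_bigr do rewrite mulr_sumr.
rewrite exchange_big /=; apply: eq_bigr => k _; rewrite mxE mulr_suml.
by apply: eq_bigr => l _; rewrite mulrA.
Qed.

Lemma mxact0 n (v : 'I_n -> C) : mxact 0 v = fun=> 0.
Proof.
by apply/funext => i; rewrite /mxact big1// => k _; rewrite mxE mul0r.
Qed.

Lemma mxact1 n (v : 'I_n -> C) : mxact 1%:M v = v.
Proof.
apply/funext => i; rewrite /mxact (bigD1 i)//= mxE eqxx mul1r big1 ?addr0//.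
by move=> k ki; rewrite mxE eq_sym (negbTE ki) mul0r.
Qed.

Lemma mxnorm_leP n (A : 'M[C]_n) (M : R) : 0 <= M ->
  (mxnorm A <= M%:E)%E <-> forall v, l2norm (mxact A v) <= M * l2norm v.
Proof.
move=> M0; split=> [AM v|AM]; last first.
  apply: ge_ereal_sup => _ [v /= v1 <-]; rewrite lee_fin.
  by rewrite (le_trans (AM v))// ler_piMr.
have [v0|v0] := eqVneq (l2norm v) 0.
  have -> : v = (fun i => 0 * v i).
    by apply/funext => i; rewrite (l2norm_eq0 v0) mul0r.
  by rewrite mxact_scale !l2normZ rnorm0 !mul0r mulr0.
have vgt0 : 0 < l2norm v by rewrite lt_def v0 l2norm_ge0.
pose a : C := (((l2norm v)^-1)%:C)%C.
have na : rnorm a = (l2norm v)^-1 by rewrite rnorm_real// invr_ge0 l2norm_ge0.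
have : ((l2norm (mxact A (fun i => a * v i)))%:E <= M%:E)%E.
  apply: le_trans AM; apply: ereal_sup_ubound.
  by exists (fun i => a * v i) => //=; rewrite l2normZ na mulVf.
by rewrite lee_fin mxact_scale l2normZ na ler_pdivrMl// mulrC.
Qed.

Lemma mxnorm_ge0 n (A : 'M[C]_n) : (0 <= mxnorm A)%E.
Proof.
apply: le_trans (ereal_sup_ubound (ex_intro2 _ _ (fun _ : 'I_n => 0) _ erefl)).
  by rewrite lee_fin l2norm_ge0.
by rewrite /= l2norm0.
Qed.

End MatrixNorm.

Section GradedMaps.
Variables (R : realType) (d : nat) (HR HS : hilbertType R).
Variable Q : 'I_d -> {linear HR -> HS}.
Local Notation C := (Cplx R).
Local Notation gmap := (gmap Q).
Implicit Types f g h : gmap.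

HB.instance Definition _ := gen_eqMixin gmap.
HB.instance Definition _ := gen_choiceMixin gmap.

Lemma gmapP f g : (forall n X, f n X = g n X) -> f = g.
Proof. by move=> fg; apply: functional_extensionality_dep => n; apply/funext. Qed.

Lemma ncball0 n : ncball Q n (fun=> 0).
Proof.
rewrite /ncball /=; apply: (@le_lt_trans _ _ 0%E); last by rewrite lte_fin.
apply: ge_ereal_sup => _ [v _ <-].
have -> : Qop Q (fun=> 0) v = fun=> 0.
  apply/funext => i; rewrite /Qop big1// => j _; rewrite big1// => k _.
  by rewrite mxE scale0r.
by rewrite l2norm0.
Qed.

Let gzero : gmap := fun n X => 0.
Let gopp f : gmap := fun n X => - f n X.
Let gadd f g : gmap := fun n X => f n X + g n X.
Let gone : gmap := fun n X => 1%:M.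
Let gmul f g : gmap := fun n X => f n X *m g n X.
Let gscale (a : C) f : gmap := fun n X => a *: f n X.

Let gaddA : associative gadd.
Proof. by move=> f g h; apply/gmapP => n X; exact: addrA. Qed.
Let gaddC : commutative gadd.
Proof. by move=> f g; apply/gmapP => n X; exact: addrC. Qed.
Let gadd0 : left_id gzero gadd.
Proof. by move=> f; apply/gmapP => n X; exact: add0r. Qed.
Let gaddN : left_inverse gzero gopp gadd.
Proof. by move=> f; apply/gmapP => n X; exact: addNr. Qed.
HB.instance Definition _ := GRing.isZmodule.Build gmap gaddA gaddC gadd0 gaddN.

Let gmulA : associative gmul.
Proof. by move=> f g h; apply/gmapP => n X; exact: mulmxA. Qed.
Let gmul1 : left_id gone gmul.
Proof. by move=> f; apply/gmapP => n X; exact: mul1mx. Qed.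
Let gmulr1 : right_id gone gmul.
Proof. by move=> f; apply/gmapP => n X; exact: mulmx1. Qed.
Let gmulDl : left_distributive gmul +%R.
Proof. by move=> f g h; apply/gmapP => n X; exact: mulmxDl. Qed.
Let gmulDr : right_distributive gmul +%R.
Proof. by move=> f g h; apply/gmapP => n X; exact: mulmxDr. Qed.
Let gone_neq0 : gone != 0.
Proof.
apply/eqP => /(congr1 (fun f : gmap => f 0%N (SigSub (mem_set (ncball0 0))))).
by move=> /matrixP/(_ 0 0)/eqP; rewrite !mxE oner_eq0.
Qed.
HB.instance Definition _ :=
  GRing.Zmodule_isNzRing.Build gmap gmulA gmul1 gmulr1 gmulDl gmulDr gone_neq0.

Let gscaleA a b f : gscale a (gscale b f) = gscale (a * b) f.
Proof. by apply/gmapP => n X; exact: scalerA. Qed.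
Let gscale1 : left_id 1 gscale.
Proof. by move=> f; apply/gmapP => n X; exact: scale1r. Qed.
Let gscaleDr : right_distributive gscale +%R.
Proof. by move=> a f g; apply/gmapP => n X; exact: scalerDr. Qed.
Let gscaleDl f : {morph gscale^~ f : a b / a + b}.
Proof. by move=> a b; apply/gmapP => n X; exact: scalerDl. Qed.
HB.instance Definition _ := GRing.Zmodule_isLmodule.Build C gmap
  gscaleA gscale1 gscaleDr gscaleDl.

Let gscaleAl (a : C) f g : a *: (f * g) = a *: f * g.
Proof. by apply/gmapP => n X; exact: scalemxAl. Qed.
HB.instance Definition _ := GRing.Lmodule_isLalgebra.Build C gmap gscaleAl.

Let gscaleAr (a : C) f g : a *: (f * g) = f * (a *: g).
Proof. by apply/gmapP => n X; exact: scalemxAr. Qed.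
HB.instance Definition _ := GRing.Lalgebra_isAlgebra.Build C gmap gscaleAr.

Lemma gmap_0E n X : (0 : gmap) n X = 0. Proof. by []. Qed.
Lemma gmap_NE f n X : (- f) n X = - f n X. Proof. by []. Qed.
Lemma gmap_DE f g n X : (f + g) n X = f n X + g n X. Proof. by []. Qed.
Lemma gmap_1E n X : (1 : gmap) n X = 1%:M. Proof. by []. Qed.
Lemma gmap_ME f g n X : (f * g) n X = f n X *m g n X. Proof. by []. Qed.
Lemma gmap_ZE (a : C) f n X : (a *: f) n X = a *: f n X. Proof. by []. Qed.

Lemma supnorm_leP f (M : R) : 0 <= M ->
  (supnorm f <= M%:E)%E <->
  forall n X v, l2norm (mxact (f n X) v) <= M * l2norm v.
Proof.
move=> M0; split=> [fM n X|fM].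
  apply/mxnorm_leP => //; apply: le_trans fM; apply: ereal_sup_ubound.
  by exists n => //; exists X.
by apply: ge_ereal_sup => _ [n _] [X _ <-]; apply/mxnorm_leP.
Qed.

Lemma supnorm_ge0 f : (0 <= supnorm f)%E.
Proof.
pose X : ncball Q 0 := SigSub (mem_set (ncball0 0)).
apply: le_trans (mxnorm_ge0 (f _ X)) _; apply: ereal_sup_ubound.
by exists 0%N => //; exists X.
Qed.

Lemma supnorm_ltP f : (supnorm f < +oo)%E <->
  exists2 M : R, 0 <= M &
    forall n X v, l2norm (mxact (f n X) v) <= M * l2norm v.
Proof.
split=> [foo|[M M0 /(supnorm_leP _ M0) fM]]; last first.
  by apply: le_lt_trans fM _; exact: ltry.
have ffin : supnorm f \is a fin_num by rewrite ge0_fin_numE ?supnorm_ge0.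
exists (fine (supnorm f)); first by rewrite fine_ge0 ?supnorm_ge0.
by apply/supnorm_leP; rewrite ?fine_ge0 ?supnorm_ge0// fineK.
Qed.

Definition bounded_nc : {pred gmap} :=
  [pred f | `[< is_nc f /\ (supnorm f < +oo)%E >]].

End GradedMaps.
Arguments bounded_nc {R d HR HS} Q.

Section Closure.
Variables (R : realType) (d : nat) (HR HS : hilbertType R).
Variable Q : 'I_d -> {linear HR -> HS}.
Local Notation C := (Cplx R).
Implicit Types f g : gmap Q.

Lemma dsumD n m (A A' : 'M[C]_n.+1) (B B' : 'M[C]_m.+1) :
  dsum A B + dsum A' B' = dsum (A + A') (B + B').
Proof.
rewrite /dsum; apply: etrans (@add_block_mx _ n.+1 m.+1 n.+1 m.+1 _ _ _ _ _ _ _ _) _.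
by rewrite !addr0.
Qed.

Lemma dsumZ n m a (A : 'M[C]_n.+1) (B : 'M[C]_m.+1) :
  a *: dsum A B = dsum (a *: A) (a *: B).
Proof.
rewrite /dsum; apply: etrans (@scale_block_mx _ n.+1 m.+1 n.+1 m.+1 a _ _ _ _) _.
by rewrite !scaler0.
Qed.

Lemma dsumM n m (A A' : 'M[C]_n.+1) (B B' : 'M[C]_m.+1) :
  dsum A B *m dsum A' B' = dsum (A *m A') (B *m B').
Proof.
rewrite /dsum; apply: etrans (@mulmx_block _ n.+1 m.+1 n.+1 m.+1 n.+1 m.+1 _ _ _ _ _ _ _ _) _.
by rewrite !mulmx0 !mul0mx !addr0 !add0r.
Qed.

Lemma dsum1 n m : 1%:M = dsum (1%:M : 'M[C]_n.+1) (1%:M : 'M[C]_m.+1).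
Proof. exact: (@scalar_mx_block _ n.+1 m.+1). Qed.

Lemma bounded_ncP f : reflect
  (is_nc f /\ exists2 M : R, 0 <= M &
     forall n X v, l2norm (mxact (f n X) v) <= M * l2norm v)
  (f \in bounded_nc Q).
Proof.
apply: (iffP (asboolP _)) => -[fnc fb]; split => //; exact/supnorm_ltP.
Qed.

Lemma bounded_nc_lin (a : C) f g :
  f \in bounded_nc Q -> g \in bounded_nc Q -> a *: f + g \in bounded_nc Q.
Proof.
move=> /bounded_ncP[[fs fc] [M M0 fM]] /bounded_ncP[[gs gc] [N N0 gN]].
apply/bounded_ncP; split; first split.
- move=> n m X Y Z ZE; rewrite !gmap_DE !gmap_ZE (fs _ _ X Y)// (gs _ _ X Y)//.
  by rewrite dsumZ dsumD.
- move=> n S X Y Su YE; rewrite !gmap_DE !gmap_ZE (fc _ S X Y)// (gc _ S X Y)//.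
  by rewrite mulmxDr mulmxDl -scalemxAr -scalemxAl.
exists (rnorm a * M + N); first by rewrite addr_ge0// mulr_ge0// rnorm_ge0.
move=> n X v; rewrite gmap_DE gmap_ZE mxactD mxactZ.
apply: le_trans (l2normD _ _) _; rewrite l2normZ mulrDl lerD// -mulrA.
by rewrite ler_wpM2l// rnorm_ge0.
Qed.

Lemma bounded_nc1 : 1 \in bounded_nc Q.
Proof.
apply/bounded_ncP; split; first split.
- by move=> n m X Y Z _; rewrite !gmap_1E dsum1.
- by move=> n S X Y Su _; rewrite !gmap_1E mulmx1 mulVmx.
by exists 1 => // n X v; rewrite gmap_1E mxact1 mul1r.
Qed.

Lemma bounded_ncM f g :
  f \in bounded_nc Q -> g \in bounded_nc Q -> f * g \in bounded_nc Q.
Proof.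
move=> /bounded_ncP[[fs fc] [M M0 fM]] /bounded_ncP[[gs gc] [N N0 gN]].
apply/bounded_ncP; split; first split.
- move=> n m X Y Z ZE; rewrite !gmap_ME (fs _ _ X Y)// (gs _ _ X Y)//.
  by rewrite dsumM.
- move=> n S X Y Su YE; rewrite !gmap_ME (fc _ S X Y)// (gc _ S X Y)//.
  by rewrite !mulmxA mulmxK.
exists (M * N); first exact: mulr_ge0.
move=> n X v; rewrite gmap_ME mxactM; apply: le_trans (fM _ _ _) _.
by rewrite -mulrA ler_wpM2l.
Qed.

Lemma bounded_nc_subalg : subalg_closed (bounded_nc Q).
Proof.
by split; [exact: bounded_nc1 | exact: bounded_nc_lin | exact: bounded_ncM].
Qed.

HB.instance Definition _ :=
  GRing.isSubalgClosed.Build C (gmap Q) (bounded_nc Q) bounded_nc_subalg.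

Record Hinf := MkHinf { hval : gmap Q; hvalP : hval \in bounded_nc Q }.

HB.instance Definition _ := [isSub for hval].
HB.instance Definition _ := [Choice of Hinf by <:].
HB.instance Definition _ := [SubChoice_isSubAlgebra of Hinf by <:].

Definition heval (F : Hinf) : forall n, ncball Q n -> 'M[C]_n.+1 := hval F.

End Closure.
Arguments Hinf {R d HR HS} Q.
Coercion heval : Hinf >-> Funclass.

Section NormTopology.
Variables (R : realType) (d : nat) (HR HS : hilbertType R).
Variable Q : 'I_d -> {linear HR -> HS}.
Local Notation C := (Cplx R).
Implicit Types F G : Hinf Q.

Lemma heval_DE F G n X : (F + G) n X = F n X + G n X.
Proof. by rewrite /heval -[hval _]/(val (F + G)) raddfD. Qed.

Lemma heval_BE F G n X : (F - G) n X = F n X - G n X.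
Proof. by rewrite /heval -[hval _]/(val (F - G)) raddfB. Qed.

Lemma heval_ZE (a : C) F n X : (a *: F) n X = a *: F n X.
Proof. by rewrite /heval -[hval _]/(val (a *: F)) linearZ. Qed.

Lemma heval_ME F G n X : (F * G) n X = F n X *m G n X.
Proof. by rewrite /heval -[hval _]/(val (F * G)) rmorphM. Qed.

(* The supremum in [supnorm] is finite on [Hinf]. *)
Definition hnorm F : C := ((fine (supnorm (hval F)))%:C)%C.

Lemma supnorm_fin F : supnorm (hval F) = (fine (supnorm (hval F)))%:E.
Proof.
rewrite fineK// ge0_fin_numE ?supnorm_ge0//.
by have /asboolP[] := hvalP F.
Qed.

Lemma fine_supnorm_ge0 F : 0 <= fine (supnorm (hval F)).
Proof. by rewrite fine_ge0// supnorm_ge0. Qed.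

Lemma supnormP F n X v :
  l2norm (mxact (F n X) v) <= fine (supnorm (hval F)) * l2norm v.
Proof.
by move: n X v; apply/supnorm_leP; rewrite ?fine_supnorm_ge0// -supnorm_fin.
Qed.

Lemma fine_supnorm_le F (M : R) : 0 <= M ->
  (forall n X v, l2norm (mxact (F n X) v) <= M * l2norm v) ->
  fine (supnorm (hval F)) <= M.
Proof. by move=> M0 FM; rewrite -lee_fin -supnorm_fin; apply/supnorm_leP. Qed.

Let hnormD F G : hnorm (F + G) <= hnorm F + hnorm G.
Proof.
have -> : hnorm F + hnorm G =
    ((fine (supnorm (hval F)) + fine (supnorm (hval G)))%:C)%C.
  by rewrite [RHS](rmorphD (real_complex R)).
rewrite /hnorm.
rewrite lecR.
apply: fine_supnorm_le => [|n X v].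
  by rewrite addr_ge0// fine_supnorm_ge0.
rewrite heval_DE mxactD.
by apply: le_trans (l2normD _ _) _; rewrite mulrDl lerD// supnormP.
Qed.

Let hnormZ_le (a : C) F :
  fine (supnorm (hval (a *: F))) <= rnorm a * fine (supnorm (hval F)).
Proof.
apply: fine_supnorm_le => [|n X v].
  by rewrite mulr_ge0 ?rnorm_ge0 ?fine_supnorm_ge0.
rewrite heval_ZE mxactZ l2normZ -mulrA.
by rewrite ler_wpM2l ?rnorm_ge0 ?supnormP.
Qed.

Let hnormZ (a : C) F : hnorm (a *: F) = `|a| * hnorm F.
Proof.
rewrite /hnorm rnormE -rmorphM; congr (_ %:C)%C; apply/eqP.
rewrite eq_le; apply/andP; split; first exact: hnormZ_le.
have [a0|a0] := eqVneq a 0.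
  have -> : rnorm a = 0 by rewrite a0 rnorm0.
  rewrite mul0r.
  exact: fine_supnorm_ge0.
have na : rnorm a != 0 by apply: contra a0 => /eqP/rnorm_eq0 ->.
have nagt0 : 0 < rnorm a by rewrite lt_def na rnorm_ge0.
have VE : rnorm a^-1 = (rnorm a)^-1.
  apply: (mulfI na); rewrite -rnormM !mulfV//.
  by rewrite /rnorm normr1.
have := hnormZ_le a^-1 (a *: F); rewrite scalerA mulVf// scale1r VE.
by rewrite ler_pdivlMl.
Qed.

Let hnorm_eq0 F : hnorm F = 0 -> F = 0.
Proof.
move=> /(congr1 (@complex.Re R)) /= F0; apply: val_inj; apply/gmapP => n X.
apply/matrixP => i k; rewrite [RHS]mxE.
have := supnormP F X (fun j => (j == k)%:R).
rewrite F0 mul0r => le0; have := l2norm_ge0 (mxact (F n X) (fun j => (j == k)%:R)).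
move=> ge0; have /l2norm_eq0/(_ i) : l2norm (mxact (F n X) (fun j => (j == k)%:R)) = 0.
  by apply/eqP; rewrite eq_le le0.
rewrite /mxact (bigD1 k)//= eqxx mulr1 big1 ?addr0// => j /negbTE ->.
by rewrite mulr0.
Qed.

HB.instance Definition _ :=
  Lmodule_isNormed.Build C (Hinf Q) hnormD hnormZ hnorm_eq0.

End NormTopology.

Section BoundedPointwise.
Variables (R : realType) (d : nat) (HR HS : hilbertType R).
Variable Q : 'I_d -> {linear HR -> HS}.
Local Notation C := (Cplx R).
Implicit Types (F G : Hinf Q) (Phi : set_system (Hinf Q)) (U : set (Hinf Q)).

(* Nets are replaced by filters. *)
Definition bounded_filter Phi := exists M : R,
  Phi [set G : Hinf Q | (supnorm (hval G) <= M%:E)%E].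

Definition cvg_pointwise Phi F := forall n (X : ncball Q n) (e : R), 0 < e ->
  Phi [set G : Hinf Q | (mxnorm (G n X - F n X) < e%:E)%E].

Definition bp_open U := forall F Phi, ProperFilter Phi ->
  bounded_filter Phi -> cvg_pointwise Phi F -> U F -> Phi U.

(* [Hinf] with the bounded-pointwise topology. By [bp_cvgP] and [bp_finest]
   below, it is the finest of the topologies in which a bounded net converges
   if and only if it converges pointwise. There is also a coarsest one, but it
   is degenerate: its closed sets are the whole space and the bounded sets
   closed under pointwise limits, so that every nonzero subspace is dense. *)
Definition Hinf_bp : Type := Hinf Q.

HB.instance Definition _ := Choice.on Hinf_bp.

Let bp_openT : bp_open setT.
Proof. by move=> F Phi PF _ _ _; exact: filterT. Qed.

Let bp_openI : setI_closed bp_open.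
Proof.
move=> U V oU oV F Phi PF bPhi cPhi [UF VF].
by apply: filterI; [exact: oU UF | exact: oV VF].
Qed.

Let bp_open_bigU (I : Type) (f : I -> set Hinf_bp) :
  (forall i, bp_open (f i)) -> bp_open (\bigcup_i f i).
Proof.
move=> of_ F Phi PF bPhi cPhi [i _ fiF].
apply: filterS (of_ i F Phi PF bPhi cPhi fiF).
exact: bigcup_sup.
Qed.

HB.instance Definition _ :=
  @isOpenTopological.Build Hinf_bp bp_open bp_openT bp_openI bp_open_bigU.

Lemma bp_openE U : open (U : set Hinf_bp) = bp_open U.
Proof. by []. Qed.

Lemma mxnormD n (A B : 'M[C]_n) : (mxnorm (A + B) <= mxnorm A + mxnorm B)%E.
Proof.
apply: ge_ereal_sup => _ [v /= v1 <-]; rewrite mxactD.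
apply: (@le_trans _ _ ((l2norm (mxact A v))%:E + (l2norm (mxact B v))%:E)%E).
  by rewrite -EFinD lee_fin l2normD.
by apply: leeD; apply: ereal_sup_ubound; exists v.
Qed.

Lemma bp_cvgP F Phi : ProperFilter Phi -> bounded_filter Phi ->
  (Phi : set_system Hinf_bp) --> (F : Hinf_bp) <-> cvg_pointwise Phi F.
Proof.
move=> PF bPhi; split=> [cPhi n X e e0|cPhi U]; last first.
  by rewrite /= => -[V [oV VF /filterS]]; apply; exact: oV VF.
apply: cPhi => /=; exists [set G : Hinf Q | (mxnorm (G n X - F n X) < e%:E)%E].
split=> //; last first.
  rewrite /= subrr; apply: (@le_lt_trans _ _ 0%E); last by rewrite lte_fin.
  by apply/mxnorm_leP => // v; rewrite mxact0 l2norm0 mul0r.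
move=> G Psi PPsi _ cPsi /= Ge.
have Gfin : mxnorm (G n X - F n X) \is a fin_num.
  by rewrite ge0_fin_numE ?mxnorm_ge0// (lt_trans Ge) ?ltry.
set r := fine (mxnorm (G n X - F n X)).
have rE : mxnorm (G n X - F n X) = r%:E by rewrite fineK.
have re : 0 < e - r by rewrite subr_gt0 -lte_fin -rE.
apply: filterS (cPsi n X _ re) => K; rewrite /mkset => KG.
have -> : K n X - F n X = (K n X - G n X) + (G n X - F n X).
  by rewrite addrA subrK.
apply: le_lt_trans (mxnormD _ _) _.
by rewrite rE -lteBrDr// -EFinB.
Qed.

Lemma bp_finest (op : set_system (Hinf Q)) :
  (forall F Phi, ProperFilter Phi -> bounded_filter Phi ->
     (forall U, op U -> U F -> Phi U) <-> cvg_pointwise Phi F) ->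
  forall U, op U -> open (U : set Hinf_bp).
Proof.
move=> opP U opU; rewrite bp_openE => F Phi PF bPhi cPhi UF.
exact: (opP F Phi PF bPhi).2.
Qed.

End BoundedPointwise.
Arguments Hinf_bp {R d HR HS} Q.

Definition bp_closure (R : realType) (d : nat) (HR HS : hilbertType R)
    (Q : 'I_d -> {linear HR -> HS}) (J : set (Hinf Q)) : set (Hinf Q) :=
  @closure (Hinf_bp Q) J.

Section Polynomials.
Variables (R : realType) (d : nat).
Local Notation C := (Cplx R).

(* The elements of the free monoid on ['I_d] are the words [FMonom s] with
   [s : seq 'I_d]. *)
Definition ncpoly := monalg.malg (monalg.fmonom 'I_d) C.

Definition peval n (X : 'I_d -> 'M[C]_n.+1) (p : ncpoly) : 'M[C]_n.+1 :=
  monalg.mmap scalar_mx (fun w : monalg.fmonom 'I_d => \prod_(i <- w) X i) p.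

Definition hpart (p : ncpoly) (k : nat) : ncpoly :=
  \sum_(w <- monalg.msupp p | monalg.fdeg w == k)
    monalg.mkmalgU w (monalg.mcoeff w p).

Definition homogeneous_poly (J : set ncpoly) :=
  forall p, J p -> forall k, J (hpart p k).

Definition series_part (c : monalg.fmonom 'I_d -> C) (k : nat) : ncpoly :=
  \sum_(s : k.-tuple 'I_d)
    monalg.mkmalgU (monalg.FMonom s) (c (monalg.FMonom s)).

End Polynomials.

Definition two_sided_ideal (T : pzRingType) (A J : set T) : Prop :=
  [/\ J `<=` A, J 0, (forall x y, J x -> J y -> J (x + y)) &
      (forall a x, A a -> J x -> J (a * x) /\ J (x * a))].

Section Nullstellensatz.
Variables (R : realType) (d : nat) (HR HS : hilbertType R).
Variable Q : 'I_d -> {linear HR -> HS}.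
Local Notation C := (Cplx R).

Definition is_poly (F : Hinf Q) (p : ncpoly R d) :=
  forall n (X : ncball Q n), F n X = peval (val X) p.

(* The topology on [Hinf Q] is that of the norm. *)
Definition Adisc : set (Hinf Q) := closure [set F | exists p, is_poly F p].

(* The terms are summed degree by degree. *)
Definition power_series (F : Hinf Q) (c : monalg.fmonom 'I_d -> C) :=
  forall n (X : ncball Q n),
    (fun N => \sum_(k < N) peval (val X) (series_part c k)) @ \oo --> F n X.

(* Meaningful because every [F] has exactly one power series. *)
Definition coefs (F : Hinf Q) : monalg.fmonom 'I_d -> C :=
  xget (fun=> 0) [set c | power_series F c].

Definition homogeneous (J : set (Hinf Q)) := forall F, J F -> forall k,
  exists2 G, J G & is_poly G (series_part (coefs F) k).

Definition zeros_poly (J : set (ncpoly R d)) n : set (ncball Q n) :=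
  [set X | forall p, J p -> peval (val X) p = 0].

Definition zeros (J : set (Hinf Q)) n : set (ncball Q n) :=
  [set X | forall F, J F -> F n X = 0].

Definition vanishing_poly (V : forall n, set (ncball Q n)) :
    set (ncpoly R d) :=
  [set p | forall n X, V n X -> peval (val X) p = 0].

Definition vanishing (A : set (Hinf Q)) (V : forall n, set (ncball Q n)) :
    set (Hinf Q) :=
  [set F | A F /\ forall n X, V n X -> F n X = 0].

End Nullstellensatz.
Arguments Adisc {R d HR HS} Q _.
Arguments zeros_poly {R d HR HS} Q J n _.
Arguments lin_indep {R d HR HS} Q.

(* Main.v *)
(* The engine is a Taylor expansion with a geometric remainder for bounded nc
   functions.  A nc function respects intertwiners: if X S = S Y, then X (+) Y
   commutes with [[1, S], [0, 1]], hence F(X) S = S F(Y).  Apply this to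
   A (x) X, where A is the weighted shift with weights s, .., s, e whose last
   row is closed by the diagonal entry 1: it has an eigenvector for the
   eigenvalue 1, its columns are orthogonal so that A (x) X stays in the ball as
   soon as s and (1 + e^2)^(1/2) times the norm of Q(X) are less than 1, and its
   leading blocks are intertwined with the creation operators on a truncated
   Fock space.  The first intertwiner exhibits F(X) and the second one the
   homogeneous polynomials F_k(X) with coefficients read off from F on the Fock
   space, so that F(X) - \sum_(k <= m) F_k(X) is a block of F(A (x) X) divided
   by s^m e.

   For a homogeneous ideal J of polynomials and p not in J, right
   multiplication by the variables on polynomials modulo J and modulo high
   degree gives nilpotent matrices that kill J but not p; a small multiple of
   them lies in the ball.  For an ideal of A, if F vanishes on V(J), then so do
   its homogeneous parts (expand F(t X)), which therefore belong to J by the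
   polynomial case, and F is the limit as r -> 1 of F(r X), itself a uniform
   limit of the \sum_(k <= m) r^k F_k. *)
Require Import Defs.
From HB Require Import structures.
From mathcomp Require Import all_boot all_order all_algebra.
From mathcomp Require Import complex finmap.
From mathcomp Require Import all_classical all_reals all_analysis.
From mathcomp Require Import ring lra.
From mathcomp.multinomials Require Import (canonicals, coercions) monalg.

Import Order.TTheory GRing.Theory Num.Theory.
Import numFieldNormedType.Exports.
Local Open Scope classical_set_scope.
Local Open Scope ring_scope.

Set Implicit Arguments.
Unset Strict Implicit.
Unset Printing Implicit Defensive.

(** * Contractions indexed by finite types *)

Lemma sum_pair (V : nmodType) (I J : finType) (g : I * J -> V) :
  \sum_p g p = \sum_i \sum_j g (i, j).
Proof. by rewrite pair_bigA; apply: eq_bigr => -[]. Qed.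

Section SquaredNorm.
Variable R : realType.
Local Notation C := (Cplx R).

(** The square of [l2norm] over any finite index type, since the tuples below are indexed by words
    and by pairs. *)
Definition sqnorm (I : finType) (V : normedZmodType C) (v : I -> V) : R :=
  \sum_i rnorm (v i) ^+ 2.

Lemma sqnorm_ge0 (I : finType) (V : normedZmodType C) (v : I -> V) :
  0 <= sqnorm v.
Proof. by apply: sumr_ge0 => i _; exact: sqr_ge0. Qed.

Lemma sqnorm_bij (I J : finType) (V : normedZmodType C) (f : I -> J)
  (v : J -> V) : bijective f -> sqnorm (fun i => v (f i)) = sqnorm v.
Proof. by move=> fb; rewrite /sqnorm (reindex f)//; exact: onW_bij. Qed.

Lemma l2normE n (V : normedZmodType C) (v : 'I_n -> V) :
  l2norm v = Num.sqrt (sqnorm v).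
Proof. by []. Qed.

Lemma l2norm_sqr n (V : normedZmodType C) (v : 'I_n -> V) :
  l2norm v ^+ 2 = sqnorm v.
Proof. exact: sqr_l2norm. Qed.

Lemma rnormZ (V : normedModType C) (a : C) (x : V) :
  rnorm (a *: x) = rnorm a * rnorm x.
Proof.
have := normrZ a x; rewrite !rnormE -rmorphM /=.
by move=> /(congr1 (@complex.Re R)).
Qed.

Lemma sqnormZ (I : finType) (V : normedModType C) (a : C) (v : I -> V) :
  sqnorm (fun i => a *: v i) = rnorm a ^+ 2 * sqnorm v.
Proof.
by rewrite /sqnorm mulr_sumr; apply: eq_bigr => i _; rewrite rnormZ exprMn.
Qed.

Lemma rnormC (x : R) : rnorm ((x%:C)%C : C) = `|x|.
Proof.
by rewrite /rnorm normc_def /= expr0n addr0 sqrtr_sqr.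
Qed.

Lemma rnormN1 : rnorm (-1 : C) = 1.
Proof. by rewrite /rnorm normrN normr1. Qed.

End SquaredNorm.

Section DirectSum.
Variables (R : realType) (n m : nat).
Local Notation C := (Cplx R).
Variables (A : 'M[C]_n.+1) (B : 'M[C]_m.+1).

Lemma dsum_lshift i k :
  dsum A B (lshift m.+1 i : 'I_(n.+1 + m.+1))
    (lshift m.+1 k : 'I_(n.+1 + m.+1)) = A i k.
Proof. exact: (@block_mxEul _ n.+1 m.+1 n.+1 m.+1). Qed.

Lemma dsum_rshift i k :
  dsum A B (rshift n.+1 i : 'I_(n.+1 + m.+1))
    (rshift n.+1 k : 'I_(n.+1 + m.+1)) = B i k.
Proof. exact: (@block_mxEdr _ n.+1 m.+1 n.+1 m.+1). Qed.

Lemma dsum_lrshift i k :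
  dsum A B (lshift m.+1 i : 'I_(n.+1 + m.+1))
    (rshift n.+1 k : 'I_(n.+1 + m.+1)) = 0.
Proof.
by apply: etrans (@block_mxEur _ n.+1 m.+1 n.+1 m.+1 _ _ _ _ _ _) _; rewrite mxE.
Qed.

Lemma dsum_rlshift i k :
  dsum A B (rshift n.+1 i : 'I_(n.+1 + m.+1))
    (lshift m.+1 k : 'I_(n.+1 + m.+1)) = 0.
Proof.
by apply: etrans (@block_mxEdl _ n.+1 m.+1 n.+1 m.+1 _ _ _ _ _ _) _; rewrite mxE.
Qed.

End DirectSum.

Section Contractions.
Variables (R : realType) (d : nat) (HR HS : hilbertType R).
Variable Q : 'I_d -> {linear HR -> HS}.
Local Notation C := (Cplx R).

(** [Qop] for kernels on a finite type instead of matrices. *)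
Definition Qker (I : finType) (X : 'I_d -> I -> I -> C) (v : I -> HR) :
    I -> HS :=
  fun i => \sum_j \sum_k X j i k *: Q j (v k).

Definition Qbound (I : finType) (X : 'I_d -> I -> I -> C) (rho : R) :=
  forall v, sqnorm (Qker X v) <= rho * sqnorm v.

(** [rho] bounds the squared norm of [Q(X)]; a constant strictly below [1] leaves room for weights
    larger than [1]. *)
Definition Qcontractive (I : finType) (X : 'I_d -> I -> I -> C) :=
  exists rho : R, [/\ 0 <= rho, rho < 1 & Qbound X rho].

Lemma QkerZ (I : finType) (X : 'I_d -> I -> I -> C) a v :
  Qker X (fun i => a *: v i) = (fun i => a *: Qker X v i).
Proof.
apply/funext => i; rewrite /Qker scaler_sumr; apply: eq_bigr => j _.
rewrite scaler_sumr; apply: eq_bigr => k _.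
by rewrite linearZ /= !scalerA mulrC.
Qed.

Lemma ncball_Qcontractive n (X : 'I_d -> 'M[C]_n.+1) :
  ncball Q n X <-> Qcontractive (fun j => X j).
Proof.
rewrite /ncball /=; split=> [Xlt1|[rho [rho0 rho1 Xrho]]].
  have X0 : (0 <= opnorm (Qop Q X))%E.
    apply: le_trans (ereal_sup_ubound (ex_intro2 _ _ (fun _ => 0) _ erefl)).
      by rewrite lee_fin l2norm_ge0.
    by rewrite /= l2norm0.
  have Xfin : opnorm (Qop Q X) \is a fin_num.
    by rewrite ge0_fin_numE// (lt_trans Xlt1)// ltry.
  pose r := fine (opnorm (Qop Q X)).
  have rE : opnorm (Qop Q X) = r%:E by rewrite fineK.
  have r0 : 0 <= r by rewrite fine_ge0.
  have r1 : r < 1 by move: Xlt1; rewrite rE lte_fin.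
  exists (r ^+ 2); split; [exact: sqr_ge0|by rewrite expr_lt1|move=> v].
  have [v0|v0] := eqVneq (l2norm v) 0.
    have -> : v = (fun i => 0 *: v i).
      by apply/funext => i; rewrite (l2norm_eq0 v0) scaler0.
    by rewrite QkerZ !sqnormZ rnorm0 expr0n/= !mul0r mulr0.
  have vgt0 : 0 < l2norm v by rewrite lt_def v0 l2norm_ge0.
  pose a : C := (((l2norm v)^-1)%:C)%C.
  have na : rnorm a = (l2norm v)^-1 by rewrite rnorm_real// invr_ge0 l2norm_ge0.
  have vE : sqnorm v = l2norm v ^+ 2 by rewrite l2norm_sqr.
  have : ((l2norm (Qop Q X (fun i => a *: v i)))%:E <= r%:E)%E.
    rewrite -rE; apply: ereal_sup_ubound; exists (fun i => a *: v i) => //=.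
    by rewrite l2normE sqnormZ na vE -exprMn mulVf// expr1n sqrtr1.
  rewrite lee_fin -(@ler_pXn2r _ 2)// ?nnegrE ?l2norm_ge0//.
  rewrite l2norm_sqr -[Qop Q X _]/(Qker (fun j => X j) _) QkerZ sqnormZ na vE.
  rewrite exprVn.
  by rewrite ler_pdivrMl ?exprn_gt0// mulrC.
apply: (@le_lt_trans _ _ (Num.sqrt rho)%:E); last first.
  by rewrite lte_fin -sqrtr1 ltr_sqrt.
apply: ge_ereal_sup => _ [v /= v1 <-]; rewrite lee_fin l2normE ler_sqrt//.
apply: le_trans (Xrho v) _; rewrite ler_piMr//.
by rewrite -l2norm_sqr expr_le1// l2norm_ge0.
Qed.

Lemma Qcontractive_bij (I J : finType) (f : I -> J) (X : 'I_d -> J -> J -> C) :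
  bijective f -> Qcontractive X -> Qcontractive (fun j a b => X j (f a) (f b)).
Proof.
move=> fb [rho [rho0 rho1 Xrho]]; exists rho; split=> // v.
have [g fK gK] := fb.
have gb : bijective g by exists f.
rewrite -(sqnorm_bij v gb).
have -> : sqnorm (Qker (fun j a b => X j (f a) (f b)) v) =
          sqnorm (Qker X (fun i => v (g i))).
  rewrite -(sqnorm_bij _ fb); congr sqnorm; apply/funext => i; rewrite /Qker.
  apply: eq_bigr => j _; rewrite [RHS](reindex f)/=; last exact: onW_bij.
  by apply: eq_bigr => k _; rewrite fK.
exact: Xrho.
Qed.

Lemma QboundS (I : finType) (X : 'I_d -> I -> I -> C) (r1 r2 : R) :
  r1 <= r2 -> Qbound X r1 -> Qbound X r2.
Proof.
by move=> r12 Xr v; apply: le_trans (Xr v) _; rewrite ler_wpM2r ?sqnorm_ge0.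
Qed.

(** The squared norm splits over the two blocks, so the larger of the two bounds serves for the
    sum. *)
Lemma Qcontractive_dsum n m (X : 'I_d -> 'M[C]_n.+1) (Y : 'I_d -> 'M[C]_m.+1) :
  Qcontractive (fun j => X j) -> Qcontractive (fun j => Y j) ->
  Qcontractive (fun j => dsum (X j) (Y j)).
Proof.
move=> [r1 [r10 r11 X1]] [r2 [r20 r21 Y2]].
exists (Num.max r1 r2); split=> [||v]; rewrite ?le_max ?r10// ?gt_max ?r11//.
pose D (V : Type) (w : 'I_(n + m.+1).+1 -> V) (i : 'I_n.+1) :=
  w (lshift m.+1 i : 'I_(n.+1 + m.+1)).
pose E (V : Type) (w : 'I_(n + m.+1).+1 -> V) (i : 'I_m.+1) :=
  w (rshift n.+1 i : 'I_(n.+1 + m.+1)).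
have split_sq (V : normedZmodType C) (w : 'I_(n + m.+1).+1 -> V) :
    sqnorm w = sqnorm (D _ w) + sqnorm (E _ w).
  by rewrite /sqnorm (@big_split_ord _ _ _ n.+1 m.+1).
rewrite !split_sq mulrDr; apply: lerD.
  have -> : D _ (Qker (fun j => dsum (X j) (Y j)) v) =
      Qker (fun j => X j) (D _ v).
    apply/funext => i; rewrite /D /Qker; apply: eq_bigr => j _.
    rewrite (@big_split_ord _ _ _ n.+1 m.+1)/= [X in _ + X]big1 ?addr0.
      by apply: eq_bigr => k _; rewrite dsum_lshift.
    by move=> k _; rewrite dsum_lrshift scale0r.
  by apply: (QboundS _ X1); rewrite le_max lexx.
have -> : E _ (Qker (fun j => dsum (X j) (Y j)) v) =
    Qker (fun j => Y j) (E _ v).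
  apply/funext => i; rewrite /E /Qker; apply: eq_bigr => j _.
  rewrite (@big_split_ord _ _ _ n.+1 m.+1)/= [X in X + _]big1 ?add0r.
    by apply: eq_bigr => k _; rewrite dsum_rshift.
  by move=> k _; rewrite dsum_rlshift scale0r.
by apply: (QboundS _ Y2); rewrite le_max lexx orbT.
Qed.

(* [A i i' = c i] if [i' = s i] and [0] otherwise; when the columns of such a
   matrix are orthogonal, its norm is the largest norm of a column. *)
Lemma Qbound_kron (I J : finType) (s : I -> I) (c : I -> R)
  (X : 'I_d -> J -> J -> C) (M rho : R) :
  0 <= rho -> (forall k, \sum_(i | s i == k) c i ^+ 2 <= M) -> Qbound X rho ->
  Qbound (fun j (a b : I * J) =>
    ((c a.1 *+ (s a.1 == b.1))%:C)%C * X j a.2 b.2) (M * rho).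
Proof.
move=> rho0 cM Xrho v.
pose g k : R := sqnorm (Qker X (fun b => v (k, b))).
have -> : sqnorm (Qker (fun j (a b : I * J) =>
    ((c a.1 *+ (s a.1 == b.1))%:C)%C * X j a.2 b.2) v) =
    \sum_i c i ^+ 2 * g (s i).
  rewrite /sqnorm; under [RHS]eq_bigr do rewrite /g /sqnorm mulr_sumr.
  rewrite pair_bigA /=; apply: eq_bigr => -[i a] _ /=.
  rewrite -[c i ^+ 2]real_normK ?num_real// -exprMn -rnormC -rnormZ.
  congr (rnorm _ ^+ 2); rewrite /Qker scaler_sumr; apply: eq_bigr => j _.
  rewrite sum_pair /= (bigD1 (s i))//= [X in _ + X]big1 ?addr0; last first.
    move=> k; rewrite eq_sym => /negbTE ->; rewrite mulr0n big1// => b _.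
    by rewrite mul0r scale0r.
  by rewrite scaler_sumr; apply: eq_bigr => b _; rewrite eqxx mulr1n scalerA.
(* Rows with the same target column [k] share the factor [g k], and [cM] bounds their total
   weight. *)
rewrite (partition_big s xpredT)//=.
apply: (@le_trans _ _ (\sum_k M * g k)).
  apply: ler_sum => k _.
  under eq_bigr => i /eqP -> do [].
  by rewrite -mulr_suml ler_wpM2r ?sqnorm_ge0.
have M0 : \sum_k M * g k <= \sum_k M * (rho * sqnorm (fun b => v (k, b))).
  apply: ler_sum => k _; apply: ler_wpM2l; last exact: Xrho.
  by apply: le_trans (cM k); apply: sumr_ge0 => i _; exact: sqr_ge0.
apply: le_trans M0 _; rewrite -!mulr_sumr mulrA.
by rewrite /sqnorm sum_pair.
Qed.

End Contractions.

(** * Intertwiners *)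

Section Enumeration.
Variables (I : finType) (i0 : I).

Let card_gt0 : (0 < #|I|)%N. Proof. by apply/card_gt0P; exists i0. Qed.

(** Level [n] has size [n.+1], hence the predecessor of the cardinal, which [i0] shows to be
    positive. *)
Definition enumS (a : 'I_#|I|.-1.+1) : I :=
  enum_val (cast_ord (prednK card_gt0) a).

Definition rankS (i : I) : 'I_#|I|.-1.+1 :=
  cast_ord (esym (prednK card_gt0)) (enum_rank i).

Lemma rankSK : cancel rankS enumS.
Proof. by move=> i; rewrite /enumS /rankS cast_ordKV enum_rankK. Qed.

Lemma enumSK : cancel enumS rankS.
Proof. by move=> a; rewrite /enumS /rankS enum_valK cast_ordK. Qed.

Lemma enumS_bij : bijective enumS.
Proof. by exists rankS; [exact: enumSK|exact: rankSK]. Qed.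

Lemma rankS_bij : bijective rankS.
Proof. by exists enumS; [exact: rankSK|exact: enumSK]. Qed.

End Enumeration.

Section Evaluation.
Variables (R : realType) (d : nat) (HR HS : hilbertType R).
Variable Q : 'I_d -> {linear HR -> HS}.
Local Notation C := (Cplx R).
Variable F : Hinf Q.

Lemma hinf_nc : is_nc (hval F).
Proof. by have /bounded_ncP[] := hvalP F. Qed.

(* Junk value [0] outside of the ball. *)
Definition hext n (X : 'I_d -> 'M[C]_n.+1) : 'M[C]_n.+1 :=
  if pselect (ncball Q n X) is left h then F n (SigSub (mem_set h)) else 0.

Lemma hextE n (X : ncball Q n) : hext (val X) = F n X.
Proof.
rewrite /hext; case: pselect => [h|]; first by congr (F n _); exact: val_inj.
by case; have := valP X; rewrite inE.
Qed.

Lemma hext_in n (X : 'I_d -> 'M[C]_n.+1) (h : ncball Q n X) :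
  hext X = F n (SigSub (mem_set h)).
Proof. by rewrite -hextE. Qed.

Lemma ncball_dsum n m (X : 'I_d -> 'M[C]_n.+1) (Y : 'I_d -> 'M[C]_m.+1) :
  ncball Q n X -> ncball Q m Y ->
  ncball Q (n + m.+1) (fun j => dsum (X j) (Y j)).
Proof.
move=> /ncball_Qcontractive X1 /ncball_Qcontractive Y1.
by apply/ncball_Qcontractive; exact: Qcontractive_dsum.
Qed.

(* If [X S = S Y], then [X (+) Y] commutes with [[1, S], [0, 1]]. *)
Lemma hext_intertwine n m (X : 'I_d -> 'M[C]_n.+1) (Y : 'I_d -> 'M[C]_m.+1)
    (S : 'M[C]_(n.+1, m.+1)) :
  ncball Q n X -> ncball Q m Y -> (forall j, X j *m S = S *m Y j) ->
  hext X *m S = S *m hext Y.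
Proof.
move=> hX hY XS; have hZ := ncball_dsum hX hY.
pose U : 'M[C]_((n + m.+1).+1) :=
  (block_mx 1%:M S 0 1%:M : 'M[C]_(n.+1 + m.+1)).
pose V : 'M[C]_((n + m.+1).+1) :=
  (block_mx 1%:M (- S) 0 1%:M : 'M[C]_(n.+1 + m.+1)).
have UV : U *m V = 1%:M.
  apply: etrans (@mulmx_block _ n.+1 m.+1 n.+1 m.+1 n.+1 m.+1 _ _ _ _ _ _ _ _) _.
  rewrite !mulmx1 !mul1mx !mulmx0 !mul0mx !addr0 add0r addNr.
  by apply/esym; exact: (@scalar_mx_block _ n.+1 m.+1).
have Uu : U \in unitmx by have [] := mulmx1_unit UV.
have commU (A : 'M[C]_n.+1) (B : 'M[C]_m.+1) :
    dsum A B *m U = (block_mx A (A *m S) 0 B : 'M[C]_(n.+1 + m.+1)).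
  apply: etrans (@mulmx_block _ n.+1 m.+1 n.+1 m.+1 n.+1 m.+1 _ _ _ _ _ _ _ _) _.
  by rewrite !mulmx1 !mulmx0 !mul0mx !addr0 !add0r.
have commU' (A : 'M[C]_n.+1) (B : 'M[C]_m.+1) :
    U *m dsum A B = (block_mx A (S *m B) 0 B : 'M[C]_(n.+1 + m.+1)).
  apply: etrans (@mulmx_block _ n.+1 m.+1 n.+1 m.+1 n.+1 m.+1 _ _ _ _ _ _ _ _) _.
  by rewrite !mul1mx !mulmx0 !mul0mx !addr0 !add0r.
have [Fs Fc] := hinf_nc.
pose Z : ncball Q (n + m.+1) := SigSub (mem_set hZ).
have FZ : F _ Z = dsum (hext X) (hext Y).
  by rewrite (hext_in hX) (hext_in hY); exact: Fs.
(* Conjugation by [U] fixes [Z], so [F Z] commutes with [U]; the upper right blocks of the two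
   products give the claim. *)
have : F _ Z = invmx U *m F _ Z *m U.
  apply: Fc => //=; apply/funext => j.
  by rewrite -mulmxA commU XS -commU' mulmxA mulVmx// mul1mx.
move=> /(congr1 (mulmx U)); rewrite !mulmxA mulmxV// mul1mx FZ.
rewrite commU commU' => E.
by have [_ -> _ _] := @eq_block_mx _ n.+1 m.+1 n.+1 m.+1 _ _ _ _ _ _ _ _ E.
Qed.

(* The value of [F] at a tuple indexed by a finite type; the point [i0] only
   witnesses that the type is not empty. *)
Definition heval_fin (I : finType) (i0 : I) (X : 'I_d -> I -> I -> C) :
    I -> I -> C :=
  fun i k => hext (fun j => \matrix_(a, b) X j (enumS i0 a) (enumS i0 b))
    (rankS i0 i) (rankS i0 k).

Lemma ncball_enum (I : finType) (i0 : I) (X : 'I_d -> I -> I -> C) :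
  Qcontractive Q X ->
  ncball Q _ (fun j => \matrix_(a, b) X j (enumS i0 a) (enumS i0 b)).
Proof.
move=> cX; apply/ncball_Qcontractive.
have := Qcontractive_bij (enumS_bij i0) cX.
by congr (Qcontractive Q _); apply/funext => j; apply/funext => a;
  apply/funext => b; rewrite mxE.
Qed.

Lemma heval_fin_intertwine (I J : finType) (i0 : I) (j0 : J)
    (X : 'I_d -> I -> I -> C) (Y : 'I_d -> J -> J -> C) (S : I -> J -> C) :
  Qcontractive Q X -> Qcontractive Q Y ->
  (forall j i k, \sum_l X j i l * S l k = \sum_l S i l * Y j l k) ->
  forall i k, \sum_l heval_fin i0 X i l * S l k =
              \sum_l S i l * heval_fin j0 Y l k.
Proof.
move=> cX cY XS i k.
pose S' : 'M[C]_(#|I|.-1.+1, #|J|.-1.+1) :=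
  \matrix_(a, b) S (enumS i0 a) (enumS j0 b).
have XS' j : \matrix_(a, b) X j (enumS i0 a) (enumS i0 b) *m S' =
    S' *m \matrix_(a, b) Y j (enumS j0 a) (enumS j0 b).
  apply/matrixP => a b; rewrite !mxE.
  transitivity (\sum_l X j (enumS i0 a) l * S l (enumS j0 b)).
    rewrite [RHS](reindex _ (onW_bij _ (enumS_bij i0))) /=.
    by apply: eq_bigr => l _; rewrite !mxE.
  rewrite XS (reindex _ (onW_bij _ (enumS_bij j0))) /=.
  by apply: eq_bigr => l _; rewrite !mxE.
have /matrixP/(_ (rankS i0 i) (rankS j0 k)) :=
  hext_intertwine (ncball_enum i0 cX) (ncball_enum j0 cY) XS'.
rewrite !mxE (reindex _ (onW_bij _ (rankS_bij i0))) /=.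
rewrite [in RHS](reindex _ (onW_bij _ (rankS_bij j0))) /= => E.
transitivity (\sum_l heval_fin i0 X i l * S' (rankS i0 l) (rankS j0 k)).
  by apply: eq_bigr => l _; rewrite mxE !rankSK.
by rewrite E; apply: eq_bigr => l _; rewrite mxE !rankSK.
Qed.

(** The enumeration relabels [X] and moves it to a level that is only provably equal to [n]; the
    relabelling matrix [S] is itself an intertwiner. *)
Lemma heval_finE n (X : ncball Q n) i k :
  heval_fin ord0 (fun j => val X j) i k = F n X i k.
Proof.
have hX : ncball Q n (val X) by have := valP X; rewrite inE.
have cX := hX; rewrite ncball_Qcontractive in cX.
pose S : 'M[C]_(n.+1, #|'I_n.+1|.-1.+1) :=
  \matrix_(a, b) (a == enumS ord0 b)%:R.
have XS j : val X j *m S = S *m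
    \matrix_(a, b) val X j (enumS ord0 a) (enumS ord0 b).
  apply/matrixP => a b; rewrite !mxE.
  rewrite (bigD1 (enumS ord0 b))//= [X in _ + X = _]big1; last first.
    by move=> l lk; rewrite mxE (negbTE lk) mulr0.
  rewrite [in RHS](bigD1 (rankS ord0 a))//= [X in _ = _ + X]big1; last first.
    move=> l li; rewrite [S _ _]mxE.
    case: (a =P enumS ord0 l) li => [->|_ _]; last by rewrite mul0r.
    by rewrite enumSK eqxx.
  by rewrite !mxE !rankSK !eqxx mulr1 mul1r !addr0.
have /matrixP/(_ i (rankS ord0 k)) :=
  hext_intertwine hX (ncball_enum ord0 cX) XS.
rewrite hextE !mxE (bigD1 k)//= [X in _ + X = _]big1; last first.
  by move=> l lk; rewrite mxE rankSK (negbTE lk) mulr0.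
rewrite [in RHS](bigD1 (rankS ord0 i))//= [X in _ = _ + X]big1; last first.
  move=> l li; rewrite [S _ _]mxE.
  case: (i =P enumS ord0 l) li => [->|_ _]; last by rewrite mul0r.
  by rewrite enumSK eqxx.
by rewrite !mxE !rankSK !eqxx mulr1 mul1r !addr0.
Qed.

Lemma heval_fin_bound (I : finType) (i0 : I) (X : 'I_d -> I -> I -> C) v :
  Qcontractive Q X ->
  sqnorm (fun i => \sum_k heval_fin i0 X i k * v k) <=
    fine (supnorm (hval F)) ^+ 2 * sqnorm v.
Proof.
move=> cX; have hX := ncball_enum i0 cX.
have := supnormP F (SigSub (mem_set hX)) (fun a => v (enumS i0 a)).
rewrite -(@ler_pXn2r _ 2)// ?nnegrE ?l2norm_ge0//; last first.
  by rewrite mulr_ge0 ?l2norm_ge0 ?fine_supnorm_ge0.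
rewrite exprMn !l2norm_sqr (sqnorm_bij v (enumS_bij i0)) -hext_in.
rewrite -(sqnorm_bij _ (rankS_bij i0)).
congr (_ <= _); congr sqnorm; apply/funext => i.
rewrite /mxact (reindex _ (onW_bij _ (rankS_bij i0))) /=.
by apply: eq_bigr => k _; rewrite rankSK.
Qed.

End Evaluation.

(** * Scaling a tuple into the ball *)

Section Scaling.
Variables (R : realType) (d : nat) (HR HS : hilbertType R).
Variable Q : 'I_d -> {linear HR -> HS}.
Local Notation C := (Cplx R).

Definition tscale (I : finType) (a : C) (X : 'I_d -> I -> I -> C) :=
  fun j i k => a * X j i k.

Lemma Qbound_scale (I : finType) (a : C) (X : 'I_d -> I -> I -> C) rho :
  Qbound Q X rho -> Qbound Q (tscale a X) (rnorm a ^+ 2 * rho).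
Proof.
move=> Xrho v.
have -> : Qker Q (tscale a X) v = fun i => a *: Qker Q X v i.
  apply/funext => i; rewrite /Qker scaler_sumr; apply: eq_bigr => j _.
  by rewrite scaler_sumr; apply: eq_bigr => k _; rewrite scalerA.
by rewrite sqnormZ -mulrA ler_wpM2l ?sqr_ge0.
Qed.

Hypothesis Q_bounded : forall j, continuous (Q j).

Lemma Q_lipschitz : exists2 B : R, 0 <= B &
  forall j x, rnorm (Q j x) <= B * rnorm x.
Proof.
have QB j : exists2 B : R, 0 <= B & forall x, rnorm (Q j x) <= B * rnorm x.
  have : bounded_near (Q j) (nbhs (0 : HR)).
    exact/continuous_linear_bounded/Q_bounded.
  move=> /linear_boundedP/pinfty_ex_gt0[[M N]].
  rewrite ltcE /= => /andP[/eqP N0 M0] MP; exists M; first exact: ltW.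
  move=> x; have := MP x.
  by rewrite N0 !rnormE -(rmorphM (real_complex R)) lecR.
pose B j := sval (cid2 (QB j)).
exists (\sum_j B j).
  by apply: sumr_ge0 => j _; rewrite /B; case: cid2.
move=> j x; apply: le_trans (_ : B j * rnorm x <= _).
  by rewrite /B; case: cid2.
apply: ler_wpM2r; first exact: rnorm_ge0.
rewrite (bigD1 j)//= lerDl; apply: sumr_ge0 => i _.
by rewrite /B; case: cid2.
Qed.

Lemma rnorm_sum (V : normedZmodType C) (I : Type) (r : seq I) (P : pred I)
    (F : I -> V) :
  rnorm (\sum_(i <- r | P i) F i) <= \sum_(i <- r | P i) rnorm (F i).
Proof.
elim/big_rec2: _ => [|i x y _ xy]; first by rewrite rnorm0.
by apply: le_trans (rnormD _ _) _; rewrite lerD2l.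
Qed.

Lemma Qbound_exists (I : finType) (X : 'I_d -> I -> I -> C) :
  exists2 M : R, 0 <= M & Qbound Q X M.
Proof.
have [B B0 QB] := Q_lipschitz.
pose K i := \sum_j \sum_k rnorm (X j i k) * B.
have K0 i : 0 <= K i.
  by do 2![apply: sumr_ge0 => ? _]; rewrite mulr_ge0// rnorm_ge0.
exists (\sum_i K i ^+ 2); first by apply: sumr_ge0 => i _; exact: sqr_ge0.
move=> v; rewrite mulr_suml {1}/sqnorm; apply: ler_sum => i _.
have nv k : rnorm (v k) <= Num.sqrt (sqnorm v).
  rewrite -[X in X <= _]ger0_norm ?rnorm_ge0// -sqrtr_sqr.
  rewrite ler_sqrt ?sqnorm_ge0//.
  by rewrite /sqnorm (bigD1 k)//= lerDl sumr_ge0// => l _; exact: sqr_ge0.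
rewrite -[X in _ <= _ * X]sqr_sqrtr ?sqnorm_ge0// -exprMn.
rewrite ler_pXn2r ?nnegrE ?rnorm_ge0 ?mulr_ge0 ?sqrtr_ge0//.
apply: le_trans (rnorm_sum _ _ _) _; rewrite /K mulr_suml.
apply: ler_sum => j _; apply: le_trans (rnorm_sum _ _ _) _.
rewrite mulr_suml; apply: ler_sum => k _; rewrite rnormZ -mulrA.
by rewrite ler_wpM2l ?rnorm_ge0// (le_trans (QB _ _))// ler_wpM2l.
Qed.

(** Brings the finite-dimensional models, truncated Fock space and quotient representation, into the
    ball. With [t = 1 / (1 + M)] one has [t ^+ 2 * M < 1]. *)
Lemma Qcontractive_small (I : finType) (X : 'I_d -> I -> I -> C) :
  exists2 t : R, 0 < t & Qcontractive Q (tscale (t%:C)%C X).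
Proof.
have [M M0 XM] := Qbound_exists X.
have M1 : 0 < 1 + M by rewrite ltr_pwDl.
exists (1 + M)^-1; first by rewrite invr_gt0.
exists ((1 + M)^-1 ^+ 2 * M); split.
- by rewrite mulr_ge0// sqr_ge0.
- rewrite exprVn ltr_pdivrMl ?exprn_gt0// mulr1 expr2.
  by nra.
- have := Qbound_scale (((1 + M)^-1)%:C)%C XM.
  by rewrite rnormC real_normK ?num_real.
Qed.

End Scaling.

Section PolynomialEvaluation.
Variables (R : realType) (d n : nat).
Local Notation C := (Cplx R).
Local Notation word := (monalg.fmonom 'I_d).
Implicit Types (X : 'I_d -> 'M[C]_n.+1) (p q : ncpoly R d) (w : word).

Definition wprod X (w : seq 'I_d) : 'M[C]_n.+1 := \prod_(i <- w) X i.

Lemma pevalE X p :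
  peval X p = \sum_(w <- monalg.msupp p) monalg.mcoeff w p *: wprod X w.
Proof.
rewrite /peval /monalg.mmap; apply: eq_bigr => w _.
by rewrite -[_ * _]/(_ *m _) mul_scalar_mx.
Qed.

Lemma pevalD X : {morph peval X : p q / p + q}.
Proof. by move=> p q; rewrite /peval raddfD. Qed.

Lemma peval0 X : peval X 0 = 0.
Proof. by rewrite /peval raddf0. Qed.

Lemma peval_sum X I (r : seq I) (P : pred I) (f : I -> ncpoly R d) :
  peval X (\sum_(i <- r | P i) f i) = \sum_(i <- r | P i) peval X (f i).
Proof. by rewrite /peval raddf_sum. Qed.

Lemma pevalU X (w : word) (a : C) :
  peval X (monalg.mkmalgU w a) = a *: wprod X w.
Proof.
by rewrite /peval monalg.mmapU -[_ * _]/(_ *m _) mul_scalar_mx.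
Qed.

Lemma pevalZ X (a : C) p : peval X (a *: p) = a *: peval X p.
Proof.
rewrite monalg.malgZ_def /monalg.fgscale peval_sum pevalE scaler_sumr.
by apply: eq_bigr => w _; rewrite pevalU scalerA.
Qed.

Lemma pevalM X p q : peval X (p * q) = peval X p * peval X q.
Proof.
rewrite monalg.malgME peval_sum (pevalE X p) mulr_suml; apply: eq_bigr => v _.
rewrite peval_sum (pevalE X q) mulr_sumr; apply: eq_bigr => w _.
rewrite pevalU /wprod monalg.fmM big_cat /=.
by rewrite -scalerAl -scalerAr scalerA.
Qed.

Lemma peval_series_part X c k :
  peval X (series_part c k) =
    \sum_(t : k.-tuple 'I_d) c (monalg.FMonom t) *: wprod X t.
Proof.
by rewrite /series_part peval_sum; apply: eq_bigr => t _; rewrite pevalU.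
Qed.

End PolynomialEvaluation.

(** * Taylor expansion *)

Section FockShift.
Variables (R : realType) (d : nat) (HR HS : hilbertType R).
Variable Q : 'I_d -> {linear HR -> HS}.
Local Notation C := (Cplx R).
Hypothesis Q_bounded : forall j, continuous (Q j).

(* The left creation operators on the span of the words of length at most
   [k], the longest words being sent to [0]. *)
Definition fock k (i : 'I_d) (u w : k.-bseq 'I_d) : C :=
  ((u : seq 'I_d) == i :: w)%:R.

(** Depends on [Q] and [k] alone, so all coefficients of length [k] are read off from one point. The
    default [1] is never taken when the [Q j] are continuous. *)
Definition fock_radius k : R :=
  xget 1 [set t | 0 < t /\ Qcontractive Q (tscale (t%:C)%C (@fock k))].

Lemma fock_radiusP k : 0 < fock_radius k /\
  Qcontractive Q (tscale ((fock_radius k)%:C)%C (@fock k)).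
Proof.
have [t t0 tc] := Qcontractive_small Q_bounded (@fock k).
by apply: (@xgetPex _ 1 [set t | 0 < t /\ _]); exists t.
Qed.

(** At [t] times the creation operators, a power series sends the empty word to the sum of the
    [t ^+ size w * c w] times [w]. Dividing the entry in row [w] by [t ^+ k] thus recovers [c w]
    when [size w = k], the only case in use. *)
Definition word_coef (F : Hinf Q) k (w : seq 'I_d) : C :=
  ((fock_radius k)%:C)%C ^- k *
  heval_fin F [bseq] (tscale ((fock_radius k)%:C)%C (@fock k))
    (insub_bseq k w) [bseq].

Definition taylor_coef (F : Hinf Q) (w : monalg.fmonom 'I_d) : C :=
  word_coef F (size w) w.

Lemma sum_bseq_tuple (V : nmodType) k (f : seq 'I_d -> V) :
  \sum_(u : k.-bseq 'I_d | size u == k) f u = \sum_(t : k.-tuple 'I_d) f t.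
Proof.
rewrite (reindex_omap (fun t : k.-tuple 'I_d => bseq_of_tuple t)
  (fun u : k.-bseq 'I_d => insub (val u)))/=.
  apply: eq_bigl => t; rewrite size_tuple eqxx /=.
  by rewrite (_ : insub _ = Some t) ?eqxx//; exact: (valK t).
move=> u uk; rewrite insubT//=.
by congr Some; apply: val_inj.
Qed.

Lemma peval_taylor_coef (F : Hinf Q) n (X : 'I_d -> 'M[C]_n.+1) k :
  peval X (series_part (taylor_coef F) k) =
    \sum_(t : k.-tuple 'I_d) word_coef F k t *: wprod X t.
Proof.
rewrite peval_series_part; apply: eq_bigr => t _; congr (_ *: _).
by rewrite /taylor_coef /= size_tuple.
Qed.

End FockShift.

Section Taylor.
Variables (R : realType) (d : nat) (HR HS : hilbertType R).
Variable Q : 'I_d -> {linear HR -> HS}.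
Local Notation C := (Cplx R).
Hypothesis Q_bounded : forall j, continuous (Q j).
Variables (F : Hinf Q) (n : nat) (X : ncball Q n) (m : nat) (s e rho : R).
Hypotheses (s0 : 0 < s) (e0 : 0 < e) (rho0 : 0 <= rho).
Hypothesis Xrho : Qbound Q (fun j => val X j) rho.
Hypothesis s_rho : s ^+ 2 * rho < 1.
Hypothesis e_rho : (1 + e ^+ 2) * rho < 1.

(* Row [a] of the matrix [A] has the only nonzero entry [tweight a], in column
   [a + 1] (column [a] for the last row), and [tvec] is an eigenvector of [A]
   for the eigenvalue [1]. *)
Let tnext (a : 'I_m.+2) : 'I_m.+2 := inord (minn a.+1 m.+1).
Let tweight (a : 'I_m.+2) : R :=
  if (a < m)%N then s else if (a == m :> nat) then e else 1.
Let tvec (a : nat) : R := if (a <= m)%N then s ^+ (m - a) * e else 1.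

Let T : 'I_d -> 'I_m.+2 * 'I_n.+1 -> 'I_m.+2 * 'I_n.+1 -> C :=
  fun j a b => ((tweight a.1 *+ (tnext a.1 == b.1))%:C)%C * val X j a.2 b.2.

Let tnextE a : tnext a = minn a.+1 m.+1 :> nat.
Proof. by rewrite /tnext inordK// ltnS geq_minr. Qed.

Let tvecE (a : 'I_m.+2) : tvec a = tweight a * tvec (tnext a).
Proof.
rewrite tnextE /tvec /tweight; have := ltn_ord a; rewrite ltnS leq_eqVlt.
case/orP => [/eqP ->|am].
  rewrite (minn_idPr (leqnSn _)) ltnn (gtn_eqF (ltnSn m)).
  by rewrite ltnNge leqnSn mulr1.
rewrite (minn_idPl am) -ltnS am; have [lt_am|le_ma] := ltnP a m.
  by rewrite mulrA -exprS -subSn// subSS.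
have -> : a = m :> nat by apply/eqP; rewrite eqn_leq le_ma -ltnS am.
by rewrite subnn mul1r eqxx mulr1.
Qed.

Let tvec_gt0 a : 0 < tvec a.
Proof. by rewrite /tvec; case: ifP => // _; rewrite mulr_gt0// exprn_gt0. Qed.

Let M := Num.max (s ^+ 2) (1 + e ^+ 2).

(** Column [0] of [A] is zero, columns [1] to [m] hold a single [s], and the last one holds [e] and
    [1], whence the two terms of [M]. *)
Let tweight_col (k : 'I_m.+2) : \sum_(a | tnext a == k) tweight a ^+ 2 <= M.
Proof.
have E2 : e ^+ 2 <= M by rewrite /M le_max; apply/orP; right; rewrite lerDr.
rewrite big_mkcond big_ord_recr /=.
have tl (a : 'I_m.+1) : tnext (widen_ord (leqnSn m.+1) a) = a.+1 :> nat.
  by rewrite tnextE /=; apply/minn_idPl.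
have tx : tnext ord_max = m.+1 :> nat by rewrite tnextE; exact/minn_idPr.
have cx : tweight ord_max = 1.
  by rewrite /tweight/= ltnNge leqnSn /= (gtn_eqF (ltnSn m)).
have cl (a : 'I_m.+1) : tweight (widen_ord (leqnSn m.+1) a) =
    if (a == m :> nat) then e else s.
  by rewrite /tweight/=; have := ltn_ord a; rewrite ltnS; case: ltngtP.
have txk : (tnext ord_max == k) = (m.+1 == k) by rewrite -val_eqE /= tx.
have tlk (a : 'I_m.+1) :
    (tnext (widen_ord (leqnSn m.+1) a) == k) = (a.+1 == k).
  by rewrite -val_eqE /= tl.
rewrite cx expr1n txk; under eq_bigr => a _ do rewrite tlk cl.
have [k0|k0] := posnP k.
  rewrite k0 big1 ?add0r//.
  by rewrite /M le_max sqr_ge0.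
have km : (k.-1 < m.+1)%N by rewrite prednK// -ltnS.
rewrite (bigD1 (Ordinal km))//= big1 ?addr0; last first.
  move=> a; rewrite -val_eqE/= => ak; case: eqP => // E.
  by move: ak; rewrite -E eqxx.
rewrite prednK// eqxx.
have [km1|km1] := eqVneq (m.+1) k.
  by rewrite -km1 /= eqxx addrC /M le_max lexx orbT.
have -> : (k.-1 == m) = false.
  by apply/negbTE; apply: contra km1; rewrite -eqSS prednK// eq_sym.
by rewrite addr0 /M le_max lexx.
Qed.

Let cT : Qcontractive Q T.
Proof.
exists (M * rho); split.
- by rewrite mulr_ge0// /M le_max sqr_ge0.
- by rewrite /M; case: (leP (s ^+ 2)).
- exact: (Qbound_kron rho0 tweight_col Xrho).
Qed.

Let z0 : 'I_m.+2 * 'I_n.+1 := (ord0, ord0).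
Let FT := heval_fin F z0 T.

Let sumT (g : 'I_m.+2 * 'I_n.+1 -> C) j a p :
  \sum_b T j (a, p) b * g b =
    ((tweight a)%:C)%C * \sum_q val X j p q * g (tnext a, q).
Proof.
rewrite /T /=.
rewrite sum_pair /= (bigD1 (tnext a))//= [X in _ + X]big1 ?addr0; last first.
  move=> b; rewrite eq_sym => /negbTE ->; rewrite big1// => q _.
  by rewrite !mul0r.
by rewrite eqxx mulr_sumr; apply: eq_bigr => q _; rewrite mulrA.
Qed.

(** Since [A] fixes [tvec], the column [tvec (x) 1] intertwines [A (x) X] with [X]; the resulting
    identity is read in block row [0]. *)
Let taylor_eigen p q :
  \sum_a FT (ord0, p) (a, q) * ((tvec a)%:C)%C = ((tvec 0%N)%:C)%C * F n X p q.
Proof.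
have cX : Qcontractive Q (fun j => val X j).
  by apply/ncball_Qcontractive; have := valP X; rewrite inE.
pose S (a : 'I_m.+2 * 'I_n.+1) (q : 'I_n.+1) : C :=
  ((tvec a.1)%:C)%C * (a.2 == q)%:R.
have XS j i k : \sum_l T j i l * S l k = \sum_l S i l * val X j l k.
  case: i => a r; rewrite sumT {}/S /= [RHS](bigD1 r)//= [X in _ = _ + X]big1.
    rewrite addr0 eqxx mulr1 (bigD1 k)//= [X in _ * (_ + X) = _]big1.
      by rewrite addr0 eqxx mulr1 (tvecE a) (rmorphM (real_complex R)) /=; ring.
    by move=> l /negbTE ->; rewrite !mulr0.
  by move=> l; rewrite eq_sym => /negbTE ->; rewrite mulr0 mul0r.
have := heval_fin_intertwine F z0 ord0 cT cX XS (ord0, p) q.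
rewrite [RHS](bigD1 p)//= [X in _ = _ + X]big1 ?addr0; last first.
  by move=> l; rewrite eq_sym /S /= => /negbTE ->; rewrite mulr0 mul0r.
rewrite /S /= eqxx mulr1 heval_finE => <-.
rewrite sum_pair; apply: eq_bigr => a _.
rewrite (bigD1 q)//= [X in _ = _ + X]big1 ?addr0; first by rewrite eqxx mulr1.
by move=> l /negbTE ->; rewrite !mulr0.
Qed.

(** The intertwiner [S] sends a word [w] of the truncated Fock space to column [q] of [X^w], placed
    in block [k - size w] and weighted to absorb [t] and the weights of [A]. Column [[bseq]] meets
    only block [k] on one side, and block row [0] meets only the words of length [k] on the
    other. *)
Let taylor_fock p q (k : 'I_m.+1) :
  FT (ord0, p) (widen_ord (leqnSn m.+1) k, q) * ((tvec k)%:C)%C =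
    ((tvec 0%N)%:C)%C * peval (val X) (series_part (taylor_coef F) k) p q.
Proof.
have [t0 cL] := fock_radiusP Q_bounded k.
set t := fock_radius Q k in t0 cL.
have tC : (t%:C)%C != 0 :> C by rewrite eq_complex/= gt_eqF.
pose S (a : 'I_m.+2 * 'I_n.+1) (w : k.-bseq 'I_d) : C :=
  (a.1 + size w == k)%N%:R * ((t%:C)%C ^- size w * (((tvec a.1)%:C)%C *
    wprod (val X) w a.2 q)).
have XS j i w : \sum_l T j i l * S l w =
    \sum_l S i l * tscale (t%:C)%C (@fock R d k) j l w.
  case: i => a r; rewrite sumT {}/S /= /tscale /fock.
  have -> : \sum_i val X j r i * ((tnext a + size w == k)%N%:R *
      ((t%:C)%C ^- size w * (((tvec (tnext a))%:C)%C * wprod (val X) w i q))) =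
      (tnext a + size w == k)%N%:R * ((t%:C)%C ^- size w *
      (((tvec (tnext a))%:C)%C * wprod (val X) (j :: w) r q)).
    rewrite /wprod big_cons -[_ * \prod_(_ <- _) _]/(_ *m _) mxE !mulr_sumr.
    by apply: eq_bigr => i _; ring.
  (* A word of full length is killed by [fock]; on the other side no block matches, since [tnext a]
     is at least [1]. *)
  have [wk|wk] := leqP k (size w).
    rewrite (_ : (tnext a + size w == k)%N = false) ?mul0r ?mulr0.
      rewrite big1// => u _; case: (u =P j :: w :> seq _) => [uE|_].
        by have := size_bseq u; rewrite uE /= ltnNge wk.
      by rewrite !mulr0.
    apply/negbTE; rewrite neq_ltn; apply/orP; right.
    by apply: (leq_ltn_trans wk); rewrite -addn1 addnC leq_add2r tnextE leq_min.
  pose u : k.-bseq 'I_d := Bseq (wk : (size (j :: w) <= k)%N).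
  rewrite [RHS](bigD1 u)//= [X in _ = _ + X]big1 ?addr0; last first.
    move=> v vu; case: (v =P j :: w :> seq _) => [vE|_]; last by rewrite !mulr0.
    by move: vu; rewrite (_ : v = u) ?eqxx//; exact: val_inj.
  rewrite eqxx mulr1.
  (* In the last row [tnext a] is [a] and not [a + 1], but both tests fail there because
     [k <= m]. *)
  have -> : (tnext a + size w == k)%N = (a + (size w).+1 == k)%N.
    rewrite tnextE; have [am|am] := ltnP a m.+1.
      by rewrite (minn_idPl am) addSnnS.
    rewrite (minn_idPr (leqW am)); apply/idP/idP => /eqP E; exfalso.
      by have := ltn_ord k; rewrite -E ltnNge leq_addr.
    by have := ltn_ord k; rewrite -E ltnNge (leq_trans am)// leq_addr.
  rewrite (tvecE a) rmorphM /= exprS.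
  by field; rewrite ?tC ?expf_neq0.
have := heval_fin_intertwine F z0 [bseq] cT cL XS (ord0, p) [bseq].
have -> : \sum_l heval_fin F z0 T (ord0, p) l * S l [bseq] =
    FT (ord0, p) (widen_ord (leqnSn m.+1) k, q) * ((tvec k)%:C)%C.
  rewrite (bigD1 (widen_ord (leqnSn m.+1) k, q))//= [X in _ + X]big1 ?addr0.
    rewrite /S /= addn0 eqxx mul1r expr0 invr1 mul1r /wprod big_nil.
    by rewrite mxE eqxx mulr1.
  move=> [a l]; rewrite /S /= addn0 xpair_eqE negb_and -val_eqE /=.
  case/orP => [/negbTE ->|lq]; first by rewrite mul0r mulr0.
  by rewrite /wprod big_nil mxE (negbTE lq) !mulr0.
move=> ->; rewrite peval_taylor_coef summxE mulr_sumr.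
rewrite -(sum_bseq_tuple k (fun w : seq 'I_d => ((tvec 0%N)%:C)%C *
  (word_coef F k w *: wprod (val X) w) p q)).
rewrite [RHS]big_mkcond /=; apply: eq_bigr => u _; rewrite /S /= add0n.
case: eqP => [uk|_]; last by rewrite !mul0r.
rewrite mxE /word_coef -/t uk mul1r.
have -> : insub_bseq k u = u.
  by apply: val_inj; rewrite /insub_bseq val_insubd size_bseq.
by ring.
Qed.

(* [F X] minus its Taylor polynomial is the upper right block of [F (A (x) X)],
   up to the scalar [tvec 0%N = s ^+ m * e]. *)
Lemma taylor_remainder v :
  l2norm (mxact (F n X -
      \sum_(k < m.+1) peval (val X) (series_part (taylor_coef F) k)) v) <=
    fine (supnorm (hval F)) / (s ^+ m * e) * l2norm v.
Proof.
set D := _ - _.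
have DE p q : ((tvec 0%N)%:C)%C * D p q = FT (ord0, p) (ord_max, q).
  (* Blocks [0] to [m] of the eigenvector identity are the Taylor terms by [taylor_fock]; what is
     left is block [m + 1], where [tvec] is [1]. *)
  rewrite /D !mxE mulrBr -taylor_eigen big_ord_recr /= summxE mulr_sumr.
  rewrite addrAC -sumrB big1 ?add0r; last first.
    by move=> k _; rewrite -taylor_fock subrr.
  by rewrite /tvec ltnn mulr1.
(* [w] is [v] placed in the last block; block [0] of its image under [FT] is [tvec 0%N] times
   [D v]. *)
pose w (a : 'I_m.+2 * 'I_n.+1) : C := if a.1 == ord_max then v a.2 else 0.
have := heval_fin_bound F z0 w cT.
have -> : sqnorm w = sqnorm v.
  rewrite /sqnorm sum_pair.
  rewrite (bigD1 ord_max)//= [X in _ + X]big1 ?addr0.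
    by apply: eq_bigr => q _; rewrite /w eqxx.
  move=> a /negbTE am; rewrite big1// => q _.
  by rewrite /w am rnorm0 expr0n.
move=> FTw.
have : (tvec 0%N * l2norm (mxact D v)) ^+ 2 <=
    (fine (supnorm (hval F)) * l2norm v) ^+ 2.
  rewrite (exprMn _ (tvec 0%N)) (exprMn _ (fine _)) !l2norm_sqr.
  apply: le_trans FTw.
  rewrite /sqnorm mulr_sumr sum_pair.
  rewrite [X in _ <= X](bigD1 ord0)// ler_wpDr//.
    by do 2![apply: sumr_ge0 => ? _]; exact: sqr_ge0.
  rewrite le_eqVlt; apply/orP; left; apply/eqP; apply: eq_bigr => p _.
  have -> : tvec 0%N = rnorm (((tvec 0%N)%:C)%C : C).
    by rewrite rnorm_real// ltW.
  rewrite -exprMn -rnormM; congr (rnorm _ ^+ 2).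
  rewrite /mxact mulr_sumr sum_pair.
  rewrite [RHS](bigD1 ord_max)// [X in _ = _ + X]big1 ?addr0.
    by apply: eq_bigr => q _; rewrite /w eqxx mulrA DE.
  move=> a /andP[_ /negbTE am]; rewrite big1// => q _.
  by rewrite /w /= am mulr0.
have v0 := ltW (tvec_gt0 0%N); have F0 := fine_supnorm_ge0 F.
rewrite ler_pXn2r// ?nnegrE; do 1?[by apply: mulr_ge0 => //; exact: l2norm_ge0].
have -> : tvec 0%N = s ^+ m * e by rewrite /tvec subn0.
move=> H; rewrite mulrAC ler_pdivlMr ?mulr_gt0 ?exprn_gt0//.
by rewrite mulrC.
Qed.

End Taylor.

(** * Convergence and uniqueness of the power series *)

Section PowerSeries.
Variables (R : realType) (d : nat) (HR HS : hilbertType R).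
Variable Q : 'I_d -> {linear HR -> HS}.
Local Notation C := (Cplx R).
Hypothesis Q_bounded : forall j, continuous (Q j).

Lemma mxnorm_bound_entry n (A : 'M[C]_n) (M : R) :
  (forall v, l2norm (mxact A v) <= M * l2norm v) ->
  forall p q, rnorm (A p q) <= M.
Proof.
move=> AM p q; pose v (i : 'I_n) : C := (i == q)%:R.
have v1 : l2norm v = 1.
  rewrite /l2norm (bigD1 q)//= big1 ?addr0 => [|i /negbTE iq].
    by rewrite /v eqxx /rnorm normr1 expr1n sqrtr1.
  by rewrite /v iq rnorm0 expr0n.
have := AM v; rewrite v1 mulr1; apply: le_trans.
have -> : A p q = mxact A v p.
  rewrite /mxact (bigD1 q)//= /v eqxx mulr1 big1 ?addr0// => i /negbTE ->.
  by rewrite mulr0.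
rewrite -[X in X <= _]ger0_norm ?rnorm_ge0// -sqrtr_sqr ler_sqrt; last first.
  by apply: sumr_ge0 => i _; exact: sqr_ge0.
by rewrite (bigD1 p)//= lerDl sumr_ge0// => i _; exact: sqr_ge0.
Qed.

Lemma exp_small (x M eps : R) : 0 <= x -> x < 1 -> 0 < eps ->
  \forall m \near \oo, M * x ^+ m <= eps.
Proof.
move=> x0 x1 eps0.
have /cvgrPdist_le H : (fun m => M * x ^+ m) @ \oo --> (M * 0 : R).
  by apply: cvgMl_tmp; apply: cvg_expr; rewrite ger0_norm.
have := H _ eps0; apply: filterS => m; rewrite mulr0 sub0r normrN.
exact: le_trans (ler_norm _).
Qed.

Lemma peval_scale n (X : 'I_d -> 'M[C]_n.+1) (t : C) c k :
  peval (fun j => t *: X j) (series_part c k) =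
    t ^+ k *: peval X (series_part c k).
Proof.
rewrite !peval_series_part scaler_sumr; apply: eq_bigr => w _.
rewrite scalerA mulrC -scalerA; congr (_ *: _).
have -> : t ^+ k = t ^+ size w by rewrite size_tuple.
elim: (val w) => [|i s IHs]; first by rewrite /wprod !big_nil expr0 scale1r.
rewrite /wprod !big_cons /= -/(wprod _ s) IHs -/(wprod X s).
by rewrite -scalerAl -scalerAr scalerA exprS.
Qed.

Lemma ncball_scale n (X : ncball Q n) (t : R) : 0 <= t -> t <= 1 ->
  ncball Q n (fun j => (t%:C)%C *: val X j).
Proof.
move=> t0 t1; apply/ncball_Qcontractive.
have /ncball_Qcontractive[rho [rho0 rho1 Xrho]] : ncball Q n (val X).
  by have := valP X; rewrite inE.
have t21 : t ^+ 2 <= 1 by rewrite expr_le1.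
exists (t ^+ 2 * rho); split; first by rewrite mulr_ge0// sqr_ge0.
  by apply: le_lt_trans rho1; rewrite ler_piMl.
have := Qbound_scale (t%:C)%C Xrho; rewrite rnormC real_normK ?num_real//.
congr Qbound; apply/funext => j; apply/funext => a; apply/funext => b.
by rewrite mxE.
Qed.

Definition bscale n (X : ncball Q n) (t : R) (t0 : 0 <= t) (t1 : t <= 1) :
  ncball Q n := SigSub (mem_set (ncball_scale X t0 t1)).

Lemma val_bscale n (X : ncball Q n) (t : R) (t0 : 0 <= t) (t1 : t <= 1) :
  val (bscale X t0 t1) = fun j => (t%:C)%C *: val X j.
Proof. by []. Qed.

Lemma heval_bscale1 (F : Hinf Q) n (X : ncball Q n) (t0 : 0 <= 1)
    (t1 : 1 <= 1) :
  F n (bscale X t0 t1) = F n X.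
Proof.
congr (F n _); apply: val_inj; rewrite val_bscale; apply/funext => j.
by rewrite rmorph1 scale1r.
Qed.

(* The weights are [1 / t] and [e / t]. *)
Lemma taylor_remainder_scale (F : Hinf Q) n (X : ncball Q n) m (t e : R)
    (t0 : 0 < t) (t1 : t <= 1) v : 0 < e -> t ^+ 2 + e ^+ 2 <= 1 ->
  l2norm (mxact (F n (bscale X (ltW t0) t1) - \sum_(k < m.+1)
      (t%:C)%C ^+ k *: peval (val X) (series_part (taylor_coef F) k)) v) <=
    fine (supnorm (hval F)) * t ^+ m.+1 / e * l2norm v.
Proof.
move=> e0 te.
have /ncball_Qcontractive[rho [rho0 rho1 Xrho]] : ncball Q n (val X).
  by have := valP X; rewrite inE.
have Xt : Qbound Q (fun j => val (bscale X (ltW t0) t1) j) (t ^+ 2 * rho).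
  have := Qbound_scale (t%:C)%C Xrho; rewrite rnormC real_normK ?num_real//.
  congr Qbound; apply/funext => j; apply/funext => a; apply/funext => b.
  by rewrite mxE.
have tn0 : t != 0 by rewrite gt_eqF.
(* At [t X] the squared bound is [t ^+ 2 * rho], so the conditions become [rho < 1] and
   [(t ^+ 2 + e ^+ 2) * rho < 1], and the final estimate is the same for all [X]. *)
have := @taylor_remainder R d HR HS Q Q_bounded F n (bscale X (ltW t0) t1) m
  t^-1 (e / t) (t ^+ 2 * rho).
move=> /(_ _ _ _ Xt).
under eq_bigr => k _ do rewrite val_bscale peval_scale.
rewrite (_ : _ / (t^-1 ^+ m * (e / t)) =
  fine (supnorm (hval F)) * t ^+ m.+1 / e).
  apply; rewrite ?invr_gt0 ?divr_gt0//.
  - by rewrite mulr_ge0// sqr_ge0.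
  - by rewrite mulrA -exprMn mulVf// expr1n mul1r.
  rewrite mulrA (_ : (1 + (e / t) ^+ 2) * t ^+ 2 = t ^+ 2 + e ^+ 2).
    by apply: le_lt_trans rho1; rewrite ler_piMl.
  by field.
by rewrite exprVn exprS; field; rewrite ?expf_neq0 ?tn0 ?gt_eqF.
Qed.

(** Every [t X] with [t] in [[0, 1]] obeys the bound [rho] of [X], so a single choice of weights
    serves all [t]. *)
Lemma taylor_eventually_scale (F : Hinf Q) n (X : ncball Q n) (eps : R) :
  0 < eps ->
  \forall m \near \oo, forall t (t0 : 0 <= t) (t1 : t <= 1) v,
    l2norm (mxact (F n (bscale X t0 t1) - \sum_(k < m)
      (t%:C)%C ^+ k *: peval (val X) (series_part (taylor_coef F) k)) v) <=
    eps * l2norm v.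
Proof.
move=> eps0.
have /ncball_Qcontractive[rho [rho0 rho1 Xrho]] : ncball Q n (val X).
  by have := valP X; rewrite inE.
(* Both [s ^+ 2 * rho] and [(1 + e ^+ 2) * rho] equal [1 - (1 - rho) ^+ 2], and [s > 1] makes the
   remainder decay geometrically. *)
pose e := Num.sqrt (1 - rho); pose s := Num.sqrt (2 - rho).
have e2 : e ^+ 2 = 1 - rho by rewrite sqr_sqrtr// subr_ge0 ltW.
have s2 : s ^+ 2 = 2 - rho by rewrite sqr_sqrtr//; lra.
have e0 : 0 < e by rewrite sqrtr_gt0 subr_gt0.
have s1 : 1 < s by rewrite -sqrtr1 ltr_sqrt; lra.
have s0 : 0 < s by apply: lt_trans s1.
have [||N _ NP] := @exp_small s^-1 (fine (supnorm (hval F)) / e) eps _ _ eps0.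
- by rewrite invr_ge0 ltW.
- by rewrite invf_lt1.
exists N.+1 => // -[//|m] /= Nm t t0 t1 v.
have Xt : Qbound Q (fun j => val (bscale X t0 t1) j) rho.
  have := Qbound_scale (t%:C)%C Xrho; rewrite rnormC real_normK ?num_real//.
  move=> /(QboundS (r2 := rho)) -/(_ _)H.
  have := H (ler_piMl rho0 (exprn_ile1 2 t0 t1)).
  congr Qbound; apply/funext => j; apply/funext => a; apply/funext => b.
  by rewrite mxE.
under eq_bigr => k _ do rewrite -peval_scale.
apply: le_trans (taylor_remainder Q_bounded F m s0 e0 rho0 Xt _ _ v) _.
- by rewrite s2; nra.
- by rewrite e2; nra.
apply: ler_wpM2r; first exact: l2norm_ge0.
have := NP m Nm; congr (_ <= _).
by rewrite exprVn; field; rewrite ?expf_neq0 ?gt_eqF.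
Qed.

Lemma taylor_eventually (F : Hinf Q) n (X : ncball Q n) (eps : R) : 0 < eps ->
  \forall m \near \oo, forall v,
    l2norm (mxact (F n X -
      \sum_(k < m) peval (val X) (series_part (taylor_coef F) k)) v) <=
    eps * l2norm v.
Proof.
move=> /(taylor_eventually_scale F X); apply: filterS => m H v.
have := H 1 ler01 (lexx 1) v; rewrite heval_bscale1.
by under eq_bigr => k _ do rewrite rmorph1 expr1n scale1r.
Qed.

Lemma power_series_taylor (F : Hinf Q) : power_series F (taylor_coef F).
Proof.
move=> n X; apply/cvg_ballP => -[eps eps'].
rewrite ltcE /= => /andP[/eqP -> eps0].
have eps2 : 0 < eps / 2 by rewrite divr_gt0.
apply: filterS (taylor_eventually F X eps2) => m /mxnorm_bound_entry H.
split; first by rewrite ltcR.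
move=> p q; rewrite -ball_normE /= rnormE ltcR.
have := H p q; rewrite !mxE; move=> /le_lt_trans; apply.
by rewrite ltr_pdivrMr// ltr_pMr// ltr1n.
Qed.

(** Creation operators applied to the empty word build [w] letter by letter from its right end. A
    word longer than [k] gives [0] on both sides. *)
Lemma wprod_fock k (t : C) (w : seq 'I_d)
    (X : 'I_d -> 'M[C]_(#|{: k.-bseq 'I_d}|.-1.+1)) a :
  (forall j, X j = \matrix_(a, b) tscale t (@fock R d k) j
    (enumS [bseq] a) (enumS [bseq] b)) ->
  wprod X w a (rankS [bseq] [bseq]) =
    ((enumS [bseq] a : seq 'I_d) == w)%:R * t ^+ size w.
Proof.
move=> XE; elim: w a => [|j w IHw] a.
  rewrite /wprod big_nil mxE mulr1 -[a in LHS](enumSK [bseq]).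
  by rewrite (inj_eq (bij_inj (rankS_bij _))).
rewrite /wprod big_cons -/(wprod X w) -[_ * _]/(_ *m _) mxE.
under eq_bigr => b _ do rewrite IHw XE mxE /tscale /fock.
have [wk|wk] := leqP (size w) k; last first.
  rewrite big1 => [|b _].
    rewrite (_ : (_ == _) = false) ?mul0r//; apply/negbTE/eqP => E.
    by have := size_bseq (enumS [bseq] a); rewrite E /= ltnNge ltnW.
  rewrite (_ : (_ == w) = false) ?mul0r ?mulr0//; apply/negbTE/eqP => E.
  by have := size_bseq (enumS [bseq] b); rewrite E leqNgt wk.
pose u : k.-bseq 'I_d := Bseq wk.
rewrite (bigD1 (rankS [bseq] u))//= [X in _ + X]big1 ?addr0.
  by rewrite rankSK (_ : (u : seq 'I_d) = w)// eqxx /= exprS mul1r mulrCA mulrA.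
move=> b bu; rewrite (_ : (_ == w) = false) ?mul0r ?mulr0//.
apply/negbTE; apply: contra bu => /eqP E; rewrite -(enumSK [bseq] b).
by apply/eqP; congr rankS; exact: val_inj.
Qed.

(* On the truncated Fock space every power series is a finite sum. *)
Lemma power_series_unique (F : Hinf Q) c :
  power_series F c -> c = taylor_coef F.
Proof.
move=> Fc; apply/funext => w; rewrite /taylor_coef /word_coef.
set k := size w; have [t0 cL] := fock_radiusP Q_bounded k.
set t := fock_radius Q k in t0 cL *.
have tC : (t%:C)%C != 0 :> C by rewrite eq_complex/= gt_eqF.
rewrite -[c w](mulKf (expf_neq0 k tC)); congr (_ * _).
pose u : k.-bseq 'I_d := insub_bseq k w.
have uE : u = w :> seq 'I_d by rewrite /u /insub_bseq val_insubd leqnn.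
pose X : ncball Q _ := SigSub (mem_set (ncball_enum [bseq] cL)).
have -> : heval_fin F [bseq] (tscale ((t%:C)%C) (@fock R d k)) u [bseq] =
    F _ X (rankS [bseq] u) (rankS [bseq] [bseq]).
  by rewrite /heval_fin (hext_in F (ncball_enum [bseq] cL)).
(* Both sides are limits of one entry of the partial sums: it is constant from [k.+1] terms on, only
   degree [k] contributing, and it tends to the entry of [F X] by hypothesis. *)
apply: (@cvg_unique (Cplx R) (@norm_hausdorff _ _) ((fun N => (\sum_(i < N)
    peval (val X) (series_part c i)) (rankS [bseq] u)
    (rankS [bseq] [bseq])) @ \oo)).
  apply: cvg_near_cst; exists k.+1 => // N /= kN.
  rewrite summxE (bigD1 (Ordinal kN))//= [X in _ + X]big1 ?addr0; last first.
    move=> i ik; rewrite peval_series_part summxE big1// => s _.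
    rewrite mxE (wprod_fock (t := (t%:C)%C))// rankSK uE.
    rewrite (_ : (_ == _) = false) ?mul0r ?mulr0//.
    apply/negbTE; apply: contra ik => /eqP ws; rewrite -val_eqE /=.
    by rewrite /k ws size_tuple.
  have wk : size w == k by [].
  rewrite peval_series_part summxE (bigD1 (Tuple wk))//=.
  rewrite [X in _ + X]big1 ?addr0.
    rewrite mxE (wprod_fock (t := (t%:C)%C))// rankSK uE eqxx mul1r mulrC.
    by congr (_ * c _); rewrite monalg.fmK.
  move=> s sw; rewrite mxE (wprod_fock (t := (t%:C)%C))// rankSK uE.
  rewrite (_ : (_ == _) = false) ?mul0r ?mulr0//.
  apply/negbTE; apply: contra sw => /eqP ws; apply/eqP.
  by apply: val_inj.
exact: (cvg_comp _ _ (Fc _ X) (@coord_continuous _ _ _ _ _ _)).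
Qed.

Lemma coefsE (F : Hinf Q) : coefs F = taylor_coef F.
Proof.
apply: power_series_unique; rewrite /coefs.
apply: (@xgetPex _ (fun=> 0) [set c | power_series F c]).
by exists (taylor_coef F); exact: power_series_taylor.
Qed.

End PowerSeries.

(** * Polynomials as bounded nc functions *)

Section SubspaceMatrix.
Variables (K : fieldType) (N : nat) (W : set 'rV[K]_N).
Hypothesis W0 : W 0.
Hypothesis W_lin : forall a u v, W u -> W v -> W (a *: u + v).

Let W_comb m (U : 'M[K]_(m, N)) (u : 'rV_m) :
  (forall i, W (row i U)) -> W (u *m U).
Proof.
move=> WU; rewrite mulmx_sum_row.
elim/big_ind: _ => [//|x y Wx Wy|i _].
  by rewrite -[x]scale1r; exact: W_lin.
by rewrite -[_ *: row _ _]addr0; exact: W_lin.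
Qed.

(** A matrix of maximal rank with rows in [W] works: adjoining a vector of [W] to its row space
    cannot raise the rank. *)
Lemma subspace_matrix : exists U : 'M[K]_N, forall v, (v <= U)%MS <-> W v.
Proof.
pose P r := `[< exists U : 'M[K]_N, (forall i, W (row i U)) /\ \rank U = r >].
have P0 : exists r, P r.
  by exists 0%N; apply/asboolP; exists 0; split=> [i|]; rewrite ?row0 ?mxrank0.
have Pb r : P r -> (r <= N)%N.
  by move=> /asboolP[U [_ <-]]; exact: rank_leq_row.
have [r /asboolP[U [WU Ur]] rmax] := ex_maxnP P0 Pb.
exists U => v; split=> [/submxP[u ->]|Wv]; first exact: W_comb.
have WUv i : W (row i (U + v)%MS).
  have /sub_addsmxP[[a b] /= ->] := row_sub i (U + v)%MS.
  rewrite -[a *m U]scale1r; apply: W_lin; first exact: W_comb.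
  by apply: W_comb => k; rewrite row_id.
have := rmax _ (asboolT (ex_intro _ _ (conj WUv erefl))).
rewrite -Ur (geq_leqif (mxrank_leqif_sup (addsmxSl U v))) => UvU.
exact: submx_trans (addsmxSr U v) UvU.
Qed.

End SubspaceMatrix.

Section InnerProduct.
Variables (R : realType) (H : hilbertType R).
Local Notation C := (Cplx R).

(** Expand the squared norm of [<y, y> x - <x, y> y] and divide by [<y, y>]. *)
Lemma hdot_CauchySchwarz (x y : H) :
  rnorm (hdot H x y) <= rnorm x * rnorm y.
Proof.
have [->|y0] := eqVneq y 0.
  by rewrite (linear0r (hdot H)) !rnorm0 mulr0.
have yy : 0 < hdot H y y by rewrite dnorm_gt0.
have := dnorm_ge0 (hdot H) (hdot H y y *: x - hdot H x y *: y).
rewrite dnormB !dnormZ linearZl_LR linearZr_LR /=.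
have -> : (hdot H x y)^* * hdot H x y = `|hdot H x y| ^+ 2.
  by rewrite normCK mulrC.
rewrite (ger0_norm (ltW yy)) [X in _ - (_ + X)]conj_Creal; last first.
  by rewrite ger0_real// mulr_ge0 ?exprn_ge0// ltW.
have -> : hdot H y y ^+ 2 * hdot H x x + `|hdot H x y| ^+ 2 * hdot H y y -
    (hdot H y y * `|hdot H x y| ^+ 2 + hdot H y y * `|hdot H x y| ^+ 2) =
    hdot H y y * (hdot H y y * hdot H x x - `|hdot H x y| ^+ 2) by ring.
rewrite pmulr_rge0// subr_ge0 -!hnormE !rnormE -!rmorphXn -rmorphM lecR.
by rewrite -exprMn ler_pXn2r ?nnegrE ?mulr_ge0 ?rnorm_ge0// mulrC.
Qed.

End InnerProduct.

Section BoundedPolynomials.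
Variables (R : realType) (d : nat) (HR HS : hilbertType R).
Variable Q : 'I_d -> {linear HR -> HS}.
Local Notation C := (Cplx R).
Hypothesis Q_indep : lin_indep Q.

Let slice n (X : 'I_d -> 'M[C]_n.+1) (c : 'rV[C]_d) := \sum_j c 0 j *: X j.

(** The linear forms in the coordinates that are bounded on the ball. They form a subspace, which
    turns out to be the whole space. *)
Let bounded_slice : set 'rV[C]_d := [set c | exists2 B : R, 0 <= B &
  forall n (X : ncball Q n) v,
    l2norm (mxact (slice (val X) c) v) <= B * l2norm v].

Let bounded_slice0 : bounded_slice 0.
Proof.
exists 0 => // n X v; rewrite /slice big1 => [|j _]; last first.
  by rewrite mxE scale0r.
by rewrite mxact0 l2norm0 mul0r.
Qed.

Let bounded_slice_lin a c c' :
  bounded_slice c -> bounded_slice c' -> bounded_slice (a *: c + c').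
Proof.
move=> [B B0 cB] [B' B'0 c'B]; exists (rnorm a * B + B').
  by rewrite addr_ge0// mulr_ge0// rnorm_ge0.
move=> n X v.
have -> : slice (val X) (a *: c + c') = a *: slice (val X) c + slice (val X) c'.
  rewrite /slice scaler_sumr -big_split /=; apply: eq_bigr => j _.
  by rewrite !mxE scalerDl scalerA.
rewrite mxactD mxactZ; apply: le_trans (l2normD _ _) _.
by rewrite l2normZ mulrDl lerD// -mulrA ler_wpM2l ?rnorm_ge0.
Qed.

(** This slice is the compression of [Q(X)] to [x] and [y], and [Q(X)] is a contraction on the
    ball. *)
Let bounded_slice_dot (x : HR) (y : HS) :
  bounded_slice (\row_j hdot HS (Q j x) y).
Proof.
exists (rnorm x * rnorm y); first by rewrite mulr_ge0 ?rnorm_ge0.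
move=> n X v.
have /ncball_Qcontractive[rho [rho0 rho1 Xrho]] : ncball Q n (val X).
  by have := valP X; rewrite inE.
rewrite -(@ler_pXn2r _ 2)// ?nnegrE ?mulr_ge0 ?rnorm_ge0 ?l2norm_ge0//.
rewrite exprMn !l2norm_sqr; pose V k := v k *: x.
have -> : mxact (slice (val X) (\row_j hdot HS (Q j x) y)) v =
    fun i => hdot HS (Qker Q (fun j => val X j) V i) y.
  apply/funext => i; rewrite /Qker linear_sumlz /mxact.
  under [RHS]eq_bigr => j _ do rewrite linear_sumlz.
  rewrite exchange_big /=; apply: eq_bigr => k _.
  rewrite /slice summxE mulr_suml; apply: eq_bigr => j _.
  rewrite !mxE linearZ /= !linearZl_LR /= -[_ *: _ in LHS]/(_ * _).
  by ring.
apply: (@le_trans _ _ (rnorm y ^+ 2 * sqnorm (Qker Q (fun j => val X j) V))).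
  rewrite /sqnorm mulr_sumr; apply: ler_sum => i _.
  rewrite -exprMn ler_pXn2r ?nnegrE ?mulr_ge0 ?rnorm_ge0// mulrC.
  exact: hdot_CauchySchwarz.
rewrite [X in _ <= X](_ : _ = rnorm y ^+ 2 * (rnorm x ^+ 2 * sqnorm v));
  last by ring.
rewrite ler_wpM2l ?sqr_ge0//.
apply: le_trans (QboundS (ltW rho1) Xrho V) _.
rewrite mul1r /sqnorm mulr_sumr; apply: ler_sum => k _.
by rewrite /V rnormZ exprMn mulrC.
Qed.

(* A vector [c] orthogonal to all the bounded slices satisfies
   [\sum_j c j <Q j x, y> = 0] for all [x] and [y]. *)
Lemma coordinate_bounded : exists2 B : R, 0 <= B &
  forall n (X : ncball Q n) j v, l2norm (mxact (val X j) v) <= B * l2norm v.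
Proof.
have [U UW] := subspace_matrix bounded_slice0 bounded_slice_lin.
have allW c : bounded_slice c.
  apply/UW; rewrite submxE; apply/eqP/matrixP => i k.
  rewrite !mxE big1// => j _.
  suff -> : cokermx U j k = 0 by rewrite mulr0.
  (* Column [k] of [cokermx U] annihilates every bounded slice; for the slice of [x] and [z], where
     [z] is the sum to be killed, this reads [<z, z> = 0]. *)
  apply: (Q_indep (c := fun j => cokermx U j k)) => x.
  set z := \sum_j _; apply/eqP; rewrite -(dnorm_eq0 (hdot HS)); apply/eqP.
  have /UW := bounded_slice_dot x z.
  rewrite submxE => /eqP/matrixP/(_ 0 k); rewrite !mxE => <-.
  rewrite {1}/z linear_sumlz; apply: eq_bigr => l _.
  by rewrite linearZl_LR [in RHS]mulrC [X in _ = _ * X]mxE.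
have BP j : exists2 B : R, 0 <= B & forall n (X : ncball Q n) v,
    l2norm (mxact (val X j) v) <= B * l2norm v.
  have [B B0 BX] := allW (delta_mx 0 j); exists B => // n X v.
  have := BX n X v; rewrite /slice (bigD1 j)//= mxE !eqxx scale1r big1 ?addr0//.
  by move=> i /negbTE ij; rewrite mxE ij andbF scale0r.
pose B j := sval (cid2 (BP j)).
have B0 j : 0 <= B j by rewrite /B; case: cid2.
exists (\sum_j B j) => [|n X j v]; first exact: sumr_ge0.
apply: (@le_trans _ _ (B j * l2norm v)); first by rewrite /B; case: cid2.
by rewrite ler_wpM2r ?l2norm_ge0// (bigD1 j)//= lerDl sumr_ge0.
Qed.

Lemma poly_bounded (p : ncpoly R d) : exists2 B : R, 0 <= B &
  forall n (X : ncball Q n) v,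
    l2norm (mxact (peval (val X) p) v) <= B * l2norm v.
Proof.
have [B B0 BX] := coordinate_bounded.
have wB (w : seq 'I_d) n (X : ncball Q n) v :
    l2norm (mxact (wprod (val X) w) v) <= B ^+ size w * l2norm v.
  elim: w v => [|i w IHw] v; first by rewrite /wprod big_nil mxact1 mul1r.
  rewrite /wprod big_cons -/(wprod (val X) w) -[_ * _]/(_ *m _) mxactM.
  apply: le_trans (BX _ _ _ _) _; rewrite exprS -mulrA.
  by rewrite ler_wpM2l.
exists (\sum_(w <- monalg.msupp p) rnorm (monalg.mcoeff w p) * B ^+ size w).
  by apply: sumr_ge0 => w _; rewrite mulr_ge0 ?rnorm_ge0 ?exprn_ge0.
move=> n X v; rewrite pevalE mulr_suml.
elim/big_rec2: _ => [|w x A _ IH]; first by rewrite mxact0 l2norm0.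
rewrite mxactD mxactZ; apply: le_trans (l2normD _ _) _.
by rewrite lerD// l2normZ -mulrA ler_wpM2l ?rnorm_ge0.
Qed.

Definition poly_gmap (p : ncpoly R d) : gmap Q := fun n X => peval (val X) p.

Lemma poly_gmap_bounded p : poly_gmap p \in bounded_nc Q.
Proof.
apply/bounded_ncP; split; last exact: poly_bounded.
split=> [n m X Y Z ZE|n S X Y Su YE]; rewrite /poly_gmap ?ZE ?YE !pevalE.
  have wE (w : seq 'I_d) : wprod (fun j => dsum (val X j) (val Y j)) w =
      dsum (wprod (val X) w) (wprod (val Y) w).
    elim: w => [|i w IHw]; first by rewrite /wprod !big_nil; exact: dsum1.
    rewrite /wprod !big_cons -!/(wprod _ w) IHw; exact: dsumM.
  elim/big_rec3: _ => [|w A B D _ ->]; last by rewrite wE dsumZ dsumD.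
  by rewrite -[X in dsum X _](scale0r (0 : 'M[C]_n.+1))
    -[X in dsum _ X](scale0r (0 : 'M[C]_m.+1)) -dsumZ scale0r.
have wE (w : seq 'I_d) : wprod (fun j => invmx S *m val X j *m S) w =
    invmx S *m wprod (val X) w *m S.
  elim: w => [|i w IHw]; first by rewrite /wprod !big_nil mulmx1 mulVmx.
  rewrite /wprod !big_cons -!/(wprod _ w) IHw -[LHS]/(_ *m _).
  by rewrite !mulmxA mulmxK.
rewrite mulmx_sumr mulmx_suml; apply: eq_bigr => w _.
by rewrite wE -scalemxAr -scalemxAl.
Qed.

Definition poly_hinf p : Hinf Q := MkHinf (poly_gmap_bounded p).

Lemma poly_hinfP p : is_poly (poly_hinf p) p.
Proof. by []. Qed.

End BoundedPolynomials.

(** * The polynomial Nullstellensatz *)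

Section NCPolynomials.
Variables (R : realType) (d : nat).
Local Notation C := (Cplx R).
Local Notation word := (monalg.fmonom 'I_d).
Local Notation poly := (ncpoly R d).
Local Notation mono s := (monalg.mkmalgU (monalg.FMonom s) (1 : C) : poly).
Local Notation coef p := (fun w : word => monalg.mcoeff w (p : poly)).

Lemma coef_mono (s : seq 'I_d) (w : word) :
  monalg.mcoeff w (mono s) = (s == w :> seq 'I_d)%:R.
Proof. by rewrite monalg.mcoeffU monalg.fmP. Qed.

Lemma mono_mul (s t : seq 'I_d) : mono s * mono t = mono (s ++ t).
Proof.
rewrite monalg.malgM_def monalg.fgmulUU mulr1; congr monalg.mkmalgU.
by apply: val_inj; rewrite /= monalg.fmM.
Qed.

Lemma polyE (p : poly) :
  p = \sum_(w <- monalg.msupp p) monalg.mcoeff w p *: mono w.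
Proof.
rewrite {1}[p]monalg.monalgE; apply: eq_bigr => w _.
apply/monalg.malgP => v.
by rewrite monalg.mcoeffZ !monalg.mcoeffU monalg.fmK mulr_natr.
Qed.

Lemma poly_scalerAr (a : C) (p q : poly) : a *: (p * q) = p * (a *: q).
Proof.
rewrite -(monalg.mul_malgC a q) mulrA scalerAl; congr (_ * q).
rewrite [RHS]monalg.malgM_def monalg.fgmulgU.
rewrite monalg.malgZ_def /monalg.fgscale; apply: eq_bigr => w _.
by rewrite mulrC Monoid.mulm1.
Qed.

Lemma coef_sum (I : Type) (r : seq I) (P : pred I) (f : I -> poly) w :
  monalg.mcoeff w (\sum_(i <- r | P i) f i) =
    \sum_(i <- r | P i) monalg.mcoeff w (f i).
Proof. exact: raddf_sum. Qed.

Lemma coef_series_part c k (w : word) :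
  monalg.mcoeff w (series_part c k : poly) = if size w == k then c w else 0.
Proof.
rewrite /series_part coef_sum; case: eqP => wk; last first.
  rewrite big1// => t _; rewrite monalg.mcoeffU monalg.fmP.
  by case: eqP => // tw; case: wk; rewrite -tw size_tuple.
move/eqP: wk => wk; rewrite (bigD1 (Tuple wk))//= big1 ?addr0.
  by rewrite monalg.mcoeffU !monalg.fmK eqxx.
move=> t tw; rewrite monalg.mcoeffU monalg.fmP.
by case: eqP => // E; case/eqP: tw; exact: val_inj.
Qed.

Lemma hpartE (p : poly) k : hpart p k = series_part (coef p) k.
Proof.
apply/monalg.malgP => w; rewrite coef_series_part /hpart coef_sum.
transitivity (\sum_(v <- monalg.msupp p | v == w)
    if size w == k then monalg.mcoeff w p else 0).
  rewrite [LHS]big_mkcond [RHS]big_mkcond; apply: eq_bigr => v _.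
  rewrite monalg.mcoeffU; case: (eqVneq v w) => [->|_].
    by rewrite monalg.fdegE; case: ifP.
  by case: ifP.
rewrite big_const_seq; case: (boolP (w \in monalg.msupp p)) => wp.
  rewrite (_ : count _ _ = 1%N) /= ?addr0//.
  by rewrite (count_uniq_mem _ (fset_uniq _)) wp.
rewrite (_ : count _ _ = 0%N) /=.
  by rewrite monalg.mcoeff_outdom ?if_same.
by rewrite (count_uniq_mem _ (fset_uniq _)) (negbTE wp).
Qed.

Definition deg_bound (p : poly) := (\max_(w <- monalg.msupp p) size w)%N.

Lemma coef_deg_bound (p : poly) (w : word) :
  (deg_bound p < size w)%N -> monalg.mcoeff w p = 0.
Proof.
move=> pw; apply: monalg.mcoeff_outdom; apply: contraL pw => wp.
by rewrite -leqNgt /deg_bound (leq_bigmax_seq (F := fun w : word => size w)).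
Qed.

Definition trunc m (p : poly) : poly := \sum_(k < m.+1) series_part (coef p) k.

Lemma coef_trunc m p (w : word) :
  monalg.mcoeff w (trunc m p) =
    if (size w <= m)%N then monalg.mcoeff w p else 0.
Proof.
rewrite /trunc coef_sum; under eq_bigr => k _ do rewrite coef_series_part.
case: leqP => wm; last first.
  rewrite big1// => k _; case: eqP => // wk.
  by have := ltn_ord k; rewrite -wk ltnS leqNgt wm.
rewrite (bigD1 (Ordinal (wm : (size w < m.+1)%N)))//= eqxx big1 ?addr0// => k.
by rewrite -val_eqE /= eq_sym => /negbTE ->.
Qed.

Lemma trunc_deg_bound p m : (deg_bound p <= m)%N -> trunc m p = p.
Proof.
move=> pm; apply/monalg.malgP => w; rewrite coef_trunc; case: leqP => // mw.
by rewrite coef_deg_bound// (leq_ltn_trans pm).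
Qed.

Lemma truncZ m a p : trunc m (a *: p) = a *: trunc m p.
Proof.
apply/monalg.malgP => w; apply: etrans (coef_trunc m (a *: p) w) _.
apply: etrans _ (esym (monalg.mcoeffZ a (trunc m p) w)).
apply: etrans _ (congr1 ( *%R a) (esym (coef_trunc m p w))).
by case: ifP => _; [exact: monalg.mcoeffZ | rewrite mulr0].
Qed.

Lemma truncD m : {morph trunc m : p q / p + q}.
Proof.
move=> p q; apply/monalg.malgP => w; apply: etrans (coef_trunc m (p + q) w) _.
apply: etrans _ (esym (monalg.mcoeffD w (trunc m p) (trunc m q))).
apply: etrans _ (congr2 +%R (esym (coef_trunc m p w)) (esym (coef_trunc m q w))).
by case: ifP => _; [exact: monalg.mcoeffD | rewrite addr0].
Qed.

Lemma trunc0 m : trunc m 0 = 0.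
Proof.
by apply/monalg.malgP => w; rewrite coef_trunc monalg.mcoeff0 if_same.
Qed.

(* The polynomial [p (t Z)]. *)
Definition pscale (t : C) (p : poly) : poly :=
  \sum_(k < (deg_bound p).+1) t ^+ k *: series_part (coef p) k.

Lemma coef_pscale t p (w : word) :
  monalg.mcoeff w (pscale t p) = t ^+ size w * monalg.mcoeff w p.
Proof.
rewrite /pscale coef_sum.
under eq_bigr => k _ do rewrite monalg.mcoeffZ coef_series_part.
have [wm|wm] := leqP (size w) (deg_bound p); last first.
  rewrite coef_deg_bound// mulr0 big1// => k _; case: eqP => [wk|_].
    by have := ltn_ord k; rewrite -wk ltnS leqNgt wm.
  by rewrite mulr0.
rewrite (bigD1 (Ordinal (wm : (size w < (deg_bound p).+1)%N)))//= eqxx.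
rewrite big1 ?addr0// => k.
by rewrite -val_eqE /= eq_sym => /negbTE ->; rewrite mulr0.
Qed.

Lemma pscaleK t : t != 0 -> cancel (pscale t) (pscale t^-1).
Proof.
move=> t0 p; apply/monalg.malgP => w.
by rewrite !coef_pscale mulrA exprVn mulVf ?mul1r// expf_neq0.
Qed.

Lemma peval_pscale n (X : 'I_d -> 'M[C]_n.+1) t p :
  peval X (pscale t p) = peval (fun j => t *: X j) p.
Proof.
rewrite -[in RHS](trunc_deg_bound (leqnn (deg_bound p))) /trunc /pscale.
rewrite !peval_sum; apply: eq_bigr => k _.
by rewrite pevalZ peval_scale.
Qed.

Section Ideal.
Variable J : set poly.
Hypothesis J_ideal : two_sided_ideal setT J.

Lemma ideal_scale a p : J p -> J (a *: p).
Proof.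
case: J_ideal => _ _ _ JM Jp; rewrite -monalg.mul_malgC.
have [aJ _] := JM (monalg.mkmalgU (@monalg.one word) a : poly) p Logic.I Jp.
exact: aJ.
Qed.

Lemma ideal_sum (I : Type) (r : seq I) (P : pred I) (f : I -> poly) :
  (forall i, P i -> J (f i)) -> J (\sum_(i <- r | P i) f i).
Proof. by case: J_ideal => _ J0 JD _ Jf; elim/big_ind: _. Qed.

Hypothesis J_homog : homogeneous_poly J.

Lemma ideal_trunc m p : J p -> J (trunc m p).
Proof.
by move=> Jp; apply: ideal_sum => k _; rewrite -hpartE; exact: J_homog.
Qed.

Lemma ideal_pscale t p : J p -> J (pscale t p).
Proof.
move=> Jp; apply: ideal_sum => k _; apply: ideal_scale; rewrite -hpartE.
exact: J_homog.
Qed.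

Section Quotient.
Variable m : nat.
Local Notation words := (m.-bseq 'I_d).
Local Notation N := (#|{: words}|.-1.+1).
Local Notation wd := (enumS ([bseq] : words)).
Local Notation ix := (rankS ([bseq] : words)).

(* Row vectors represent the polynomials of degree at most [m], on which
   [shift j] is the right multiplication by the [j]-th variable. *)
Let vpoly (v : 'rV[C]_N) : poly := \sum_a v 0 a *: mono (wd a).

Let shift (j : 'I_d) : 'M[C]_N :=
  \matrix_(a, b) ((wd b : seq _) == rcons (wd a) j)%:R.

Let vpolyZ a v : vpoly (a *: v) = a *: vpoly v.
Proof.
rewrite /vpoly scaler_sumr; apply: eq_bigr => i _.
by rewrite mxE scalerA.
Qed.

Let vpolyD : {morph vpoly : u v / u + v}.
Proof.
move=> u v; rewrite /vpoly -big_split /=; apply: eq_bigr => i _.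
by rewrite mxE scalerDl.
Qed.

Let vpoly0 : vpoly 0 = 0.
Proof. by rewrite /vpoly big1// => i _; rewrite mxE scale0r. Qed.

Let trunc_mono (s : seq 'I_d) :
  trunc m (mono s) = \sum_b ((wd b : seq _) == s)%:R *: mono (wd b).
Proof.
apply/monalg.malgP => w; rewrite coef_trunc coef_mono coef_sum.
under eq_bigr => b _ do rewrite monalg.mcoeffZ coef_mono.
case: leqP => wm.
  rewrite (bigD1 (ix (Bseq wm)))//= rankSK /= eqxx mulr1 big1.
    by rewrite addr0 eq_sym.
  move=> b bw; rewrite (_ : (_ == w :> seq 'I_d) = false) ?mulr0//.
  apply/negbTE; apply: contra bw => /eqP E; rewrite -(enumSK [bseq] b).
  by apply/eqP; congr rankS; exact: val_inj.
rewrite big1// => b _; rewrite (_ : (_ == w :> seq 'I_d) = false) ?mulr0//.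
by apply/negbTE/eqP => E; have := size_bseq (wd b); rewrite E leqNgt wm.
Qed.

(** Rows are acted on from the right, so the letters of [w] are appended in order; a word that
    outgrows [m] is lost on both sides. *)
Let wprod_shift (w : seq 'I_d) a b :
  wprod shift w a b = ((wd b : seq _) == wd a ++ w)%:R.
Proof.
elim: w a b => [|j w IHw] a b.
  rewrite /wprod big_nil mxE cats0 eq_sym.
  by rewrite (inj_eq val_inj) (inj_eq (bij_inj (enumS_bij _))).
rewrite /wprod big_cons -/(wprod shift w) -[_ * _]/(_ *m _) mxE.
under eq_bigr => c _ do rewrite IHw mxE.
have [am|am] := ltnP (size (wd a)) m.
  have aj : (size (rcons (wd a) j) <= m)%N by rewrite size_rcons.
  rewrite (bigD1 (ix (Bseq aj)))//= rankSK /= eqxx mul1r big1 ?addr0.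
    by rewrite cat_rcons.
  move=> c ca; rewrite (_ : (_ == rcons _ _) = false) ?mul0r//.
  apply/negbTE; apply: contra ca => /eqP E; rewrite -(enumSK [bseq] c).
  by apply/eqP; congr rankS; exact: val_inj.
rewrite big1 => [|c _].
  case: eqP => // E; have := size_bseq (wd b); rewrite E size_cat /= leqNgt.
  by rewrite (leq_ltn_trans am)// -addn1 leq_add2l.
rewrite (_ : (_ == rcons _ _) = false) ?mul0r//; apply/negbTE/eqP => E.
by have := size_bseq (wd c); rewrite E size_rcons ltnNge am.
Qed.

Let vpoly_act v q : vpoly (v *m peval shift q) = trunc m (vpoly v * q).
Proof.
rewrite pevalE mulmx_sumr (big_morph vpoly vpolyD vpoly0) [in RHS](polyE q).
rewrite mulr_sumr (big_morph (trunc m) (truncD m) (trunc0 m)).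
apply: eq_bigr => w _; rewrite -scalemxAr vpolyZ -poly_scalerAr truncZ.
congr (_ *: _).
rewrite {2}/vpoly mulr_suml (big_morph (trunc m) (truncD m) (trunc0 m)).
rewrite /vpoly.
under [RHS]eq_bigr => a _ do
  rewrite -scalerAl truncZ mono_mul trunc_mono scaler_sumr.
rewrite exchange_big; apply: eq_bigr => b _; rewrite mxE scaler_suml.
by apply: eq_bigr => a _; rewrite scalerA wprod_shift.
Qed.

Let W : set 'rV[C]_N := [set v | J (vpoly v)].

(** The shifts act on the polynomials of degree at most [m] modulo [J]. That quotient is realised
    inside the full row space, on a complement of [U], which keeps the size [N]. *)
Lemma quotient_representation : ~ J 1 ->
  exists X : 'I_d -> 'M[C]_N,
    (forall q, J q -> peval X q = 0) /\
    (forall q, trunc m q = q -> peval X q = 0 -> J q).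
Proof.
move=> J1.
have W0 : W 0 by rewrite /W /= vpoly0; case: J_ideal.
have Wlin a u v : W u -> W v -> W (a *: u + v).
  rewrite /W /= vpolyD vpolyZ => Wu Wv; case: J_ideal => _ _ JD _.
  by apply: JD => //; exact: ideal_scale.
have [U UW] := subspace_matrix W0 Wlin.
(* [P] is the projection onto a complement of [U] along [U], so [A *m P = 0] exactly when the rows
   of [A] lie in [U]. *)
have [P [P0 PU]] : exists P : 'M[C]_N,
    (forall k (A : 'M[C]_(k, N)), (A <= U)%MS -> A *m P = 0) /\
    (forall k (A : 'M[C]_(k, N)), (A - A *m P <= U)%MS).
  exists (proj_mx U^C%MS U); split=> k A.
    by apply: proj_mx_0; rewrite capmxC capmx_compl.
  apply: proj_mx_compl_sub; apply: submx_full.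
  by rewrite addsmxC addsmx_compl_full.
(* Right multiplication and truncation preserve [J], so [U] is invariant; hence the compressions by
   [P] multiply as the shifts do. *)
have Uact q (v : 'rV[C]_N) : (v <= U)%MS -> (v *m peval shift q <= U)%MS.
  move=> vU; have Wv := (UW v).1 vU; apply/(UW _).2.
  rewrite /W /= vpoly_act; apply: ideal_trunc.
  case: J_ideal => _ _ _ JM.
  by have [_ vq] := JM q (vpoly v) Logic.I Wv; exact: vq.
have PAP q : P *m peval shift q *m P = peval shift q *m P.
  have : ((1%:M - P) *m peval shift q <= U)%MS.
    apply/row_subP => i; rewrite row_mul; apply: Uact.
    by rewrite linearB /= -[X in _ - row i X]mul1mx row_mul; exact: PU.
  by move=> /P0; rewrite !mulmxBl mul1mx => /eqP; rewrite subr_eq0 => /eqP.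
(* Here [q] itself lies in [J], and it is multiplied on the left by an arbitrary polynomial. *)
have actP q (v : 'rV[C]_N) : J q -> v *m (peval shift q *m P) = 0.
  move=> Jq; rewrite mulmxA; apply: P0; apply/(UW _).2; rewrite /W /= vpoly_act.
  apply: ideal_trunc; case: J_ideal => _ _ _ JM.
  by have [vq _] := JM (vpoly v) q Logic.I Jq; exact: vq.
pose X j := shift j *m P.
have wcons (Y : 'I_d -> 'M[C]_N) j w : wprod Y (j :: w) = Y j *m wprod Y w.
  by rewrite /wprod big_cons.
have PX (w : seq 'I_d) : P *m wprod X w = wprod shift w *m P.
  elim: w => [|j w IHw]; first by rewrite /wprod !big_nil mulmx1 mul1mx.
  have := PAP (mono (j :: w)); rewrite pevalU scale1r !wcons => <-.
  by rewrite -!mulmxA -IHw /X !mulmxA.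
have PXq q : P *m peval X q = peval shift q *m P.
  rewrite !pevalE mulmx_sumr mulmx_suml; apply: eq_bigr => w _.
  by rewrite -scalemxAr PX scalemxAl.
exists X; split=> [q Jq|q qm Xq0].
  (* [X] sends the empty word to [1] and not to [P], so constants have to be excluded: by
     homogeneity a nonzero constant term would lie in [J], and then [1] too. *)
  have q0 : monalg.mcoeff (monalg.FMonom [::]) q = 0.
    apply/eqP/negPn/negP => q0; apply: J1.
    have -> : (1 : poly) =
        (monalg.mcoeff (monalg.FMonom [::]) q)^-1 *: hpart q 0.
      apply/monalg.malgP => w; rewrite monalg.mcoeffZ hpartE coef_series_part.
      rewrite monalg.mcoeff1 monalg.fmP monalg.fm1 -size_eq0.
      case: eqP => [/eqP|_]; last by rewrite mulr0.
      by rewrite size_eq0 => /eqP w0; rewrite -[w in RHS]monalg.fmK w0 mulVf.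
    by apply: ideal_scale; exact: J_homog.
  have : P *m peval X q = 0.
    rewrite PXq; apply/row_matrixP => i; rewrite row0 rowE; exact: actP.
  have Xw (w : seq 'I_d) : w != [::] -> wprod X w = wprod shift w *m P.
    case: w => // j w _.
    rewrite !wcons.
    by rewrite /X -!mulmxA PX.
  rewrite PXq => <-; rewrite !pevalE mulmx_suml; apply: eq_bigr => w _.
  rewrite -scalemxAl.
  have [w0|w0] := eqVneq (w : seq _) [::]; last by rewrite Xw.
  by rewrite -[w in monalg.mcoeff w _]monalg.fmK w0 q0 !scale0r.
(* The row vector of the polynomial [1]: its image under [peval shift q] represents [q], and the
   vanishing of [peval X q] puts it in [U]. *)
pose e : 'rV[C]_N := delta_mx 0 (ix [bseq]).
have vpe : vpoly e = 1.
  rewrite /vpoly (bigD1 (ix [bseq]))//= mxE !eqxx scale1r rankSK big1 ?addr0.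
    apply/monalg.malgP => w; rewrite coef_mono monalg.mcoeff1.
    by rewrite monalg.fmP monalg.fm1 eq_sym.
  by move=> a /negbTE ae; rewrite mxE ae andbF scale0r.
have : (e *m peval shift q <= U)%MS.
  have := PU _ (e *m peval shift q).
  by rewrite -mulmxA -PXq Xq0 !mulmx0 subr0.
by move/(UW _).1; rewrite /W /= vpoly_act vpe mul1r qm.
Qed.

End Quotient.
End Ideal.
End NCPolynomials.

Section PolynomialNullstellensatz.
Variables (R : realType) (d : nat) (HR HS : hilbertType R).
Variable Q : 'I_d -> {linear HR -> HS}.
Local Notation C := (Cplx R).
Local Notation coef p := (fun w => monalg.mcoeff w (p : ncpoly R d)).
Hypothesis Q_bounded : forall j, continuous (Q j).

Lemma poly_nullstellensatz (J : set (ncpoly R d)) :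
  two_sided_ideal setT J -> homogeneous_poly J ->
  vanishing_poly (zeros_poly Q J) = J.
Proof.
move=> J_ideal J_homog; apply/seteqP; split=> [p pV|p Jp n X]; last exact.
have [J1|J1] := pselect (J 1).
  case: J_ideal => _ _ _ JM.
  by have [pJ _] := JM p 1 Logic.I J1; rewrite -[p]mulr1; exact: pJ.
have [X [XJ Xq]] := quotient_representation J_ideal J_homog (deg_bound p) J1.
(* Homogeneity makes [J] stable under [pscale]: [t X] still kills [J], and [p] is recovered from
   [pscale t p]. *)
have [t t0 ct] := Qcontractive_small Q_bounded (fun j => X j).
have tC : (t%:C)%C != 0 :> C by rewrite eq_complex/= gt_eqF.
have bX : ncball Q _ (fun j => (t%:C)%C *: X j).
  apply/ncball_Qcontractive; move: ct; congr Qcontractive.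
  by apply/funext => j; apply/funext => a; apply/funext => b; rewrite mxE.
have := pV _ (SigSub (mem_set bX)); rewrite -peval_pscale => pX.
rewrite -(pscaleK tC p); apply: ideal_pscale => //; apply: Xq.
  apply/monalg.malgP => w; rewrite coef_trunc coef_pscale; case: leqP => // pw.
  by rewrite coef_deg_bound// mulr0.
by apply: pX => q Jq /=; rewrite -peval_pscale XJ//; exact: ideal_pscale.
Qed.

Lemma power_series_poly (F : Hinf Q) p : is_poly F p -> power_series F (coef p).
Proof.
move=> Fp n X; apply: cvg_near_cst; exists (deg_bound p).+1 => // -[//|m] /= pm.
by rewrite -peval_sum -/(trunc m p) trunc_deg_bound// Fp.
Qed.

(** Reconciles the two notions of homogeneity on polynomials, by uniqueness of the power series. *)
Lemma hinf_poly_series (F : Hinf Q) p k : is_poly F p ->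
  series_part (coefs F) k = hpart p k.
Proof.
move=> Fp; rewrite hpartE (coefsE Q_bounded F).
by rewrite -(power_series_unique Q_bounded (power_series_poly Fp)).
Qed.

End PolynomialNullstellensatz.

(** * Homogeneous ideals of bounded functions *)

Section Ideals.
Variables (R : realType) (d : nat) (HR HS : hilbertType R).
Variable Q : 'I_d -> {linear HR -> HS}.
Local Notation C := (Cplx R).
Local Notation coef p := (fun w => monalg.mcoeff w (p : ncpoly R d)).
Hypothesis Q_bounded : forall j, continuous (Q j).
Hypothesis Q_indep : lin_indep Q.
Variables A J : set (Hinf Q).
Hypothesis A_poly : forall F p, is_poly F p -> A F.
Hypothesis J_ideal : two_sided_ideal A J.
Hypothesis J_homog : homogeneous J.

(** The trace of [J] on polynomials, to which the polynomial case applies. *)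
Let Jpoly : set (ncpoly R d) := [set p | exists2 F, J F & is_poly F p].

Let Jpoly_ideal : two_sided_ideal setT Jpoly.
Proof.
case: J_ideal => _ J0 JD JM; split=> [p _||p q|a p _]; first by [].
- exists 0 => // n X; rewrite peval0 -(subrr (0 : Hinf Q)) heval_BE.
  exact: subrr.
- move=> [F JF Fp] [G JG Gq]; exists (F + G); first exact: JD.
  by move=> n X; rewrite heval_DE Fp Gq pevalD.
move=> [F JF Fp]; have aP := poly_hinfP Q_indep a.
have [aF Fa] := JM _ _ (A_poly aP) JF; split.
  exists (poly_hinf Q_indep a * F); first exact: aF.
  by move=> n X; rewrite heval_ME Fp aP pevalM.
exists (F * poly_hinf Q_indep a); first exact: Fa.
by move=> n X; rewrite heval_ME Fp aP pevalM.
Qed.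

Let Jpoly_homog : homogeneous_poly Jpoly.
Proof.
move=> p [F JF Fp] k; have [G JG Gp] := J_homog JF k.
by exists G => //; rewrite -(hinf_poly_series Q_bounded k Fp).
Qed.

Let J_parts F k : J F -> Jpoly (series_part (taylor_coef F) k).
Proof.
move=> JF; have [G JG Gp] := J_homog JF k.
by rewrite -(coefsE Q_bounded F); exists G.
Qed.

Lemma entry_small n (B : 'M[C]_n) :
  (forall eps : R, 0 < eps -> forall p q, rnorm (B p q) <= eps) -> B = 0.
Proof.
move=> B0; apply/matrixP => p q; rewrite mxE; apply: rnorm_eq0.
apply/eqP; rewrite eq_le rnorm_ge0 andbT; apply/ler_addgt0Pr => eps eps0.
by rewrite add0r; exact: B0.
Qed.

(** A function of [J] is at each point the limit of its Taylor sums, whose terms lie in [J]. *)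
Let zeros_Jpoly n (X : ncball Q n) :
  (forall q, Jpoly q -> peval (val X) q = 0) -> zeros J X.
Proof.
move=> XJ F JF; apply: entry_small => eps eps0 p q.
have [N _ /(_ _ (leqnn N)) H] := taylor_eventually Q_bounded F X eps0.
have := mxnorm_bound_entry H p q.
by rewrite big1 ?subr0// => k _; apply: XJ; exact: J_parts.
Qed.

(* If [F] vanishes at [t X] for all small [t], then so do its homogeneous
   parts at [X], one after the other. *)
Lemma vanishing_parts (F : Hinf Q) k : (forall n X, zeros J X -> F n X = 0) ->
  exists2 G, J G & is_poly G (series_part (taylor_coef F) k).
Proof.
move=> FV; rewrite -[exists2 G, _ & _]/(Jpoly _).
rewrite -(poly_nullstellensatz Q_bounded Jpoly_ideal Jpoly_homog) => n X XJ.
elim/ltn_ind: k => k IH; apply: entry_small => eps eps0 p q.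
pose M := fine (supnorm (hval F)).
have M0 : 0 <= M by exact: fine_supnorm_ge0.
(* [t <= 1/2] allows [e = 1/2], so the remainder is at most [2 * M * t ^+ k.+1], hence at most
   [eps * t ^+ k] by the second bound; the [+ 1] avoids a zero denominator. *)
pose t := Num.min (2^-1) (eps / (2 * M + 1)).
have M1 : 0 < 2 * M + 1 by rewrite ltr_wpDl// mulr_ge0.
have t0 : 0 < t by rewrite lt_min invr_gt0 ltr0n /= divr_gt0.
have t2 : t <= 2^-1 by rewrite ge_min lexx.
have t1 : t <= 1 by apply: le_trans t2 _; rewrite invf_le1// ler1n.
have te : t * (2 * M + 1) <= eps by rewrite -ler_pdivlMr// ge_min lexx orbT.
have F0 : F n (bscale X (ltW t0) t1) = 0.
  apply: FV; apply: zeros_Jpoly => r Jr; rewrite val_bscale -peval_pscale.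
  by apply: XJ; exact: ideal_pscale.
have e0 : 0 < 2^-1 :> R by rewrite invr_gt0 ltr0n.
have te2 : t ^+ 2 + 2^-1 ^+ 2 <= 1 :> R by nra.
have := mxnorm_bound_entry
  (fun v => taylor_remainder_scale Q_bounded F X k t0 t1 v e0 te2) p q.
(* The terms of degree less than [k] vanish by induction, so up to sign the remainder is [t ^+ k]
   times the part of degree [k]. *)
rewrite F0 sub0r big_ord_recr /= big1 ?add0r; last first.
  by move=> i _; rewrite IH ?scaler0.
rewrite !mxE -mulN1r rnormM rnormM -/M.
rewrite rnormN1 mul1r -(rmorphXn (real_complex R)) rnormC.
rewrite (ger0_norm (exprn_ge0 k (ltW t0))).
rewrite invrK exprS => H.
have tk : 0 < t ^+ k by rewrite exprn_gt0.
rewrite -(ler_pM2l tk); apply: le_trans H _.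
rewrite (_ : M * (t * t ^+ k) * 2 = t ^+ k * (t * (2 * M))); last by ring.
rewrite ler_pM2l//; apply: le_trans te; rewrite ler_pM2l// lerDl ler01 //.
Qed.

Lemma dilated_partial_sum (F : Hinf Q) (r : R) m :
  (forall n X, zeros J X -> F n X = 0) ->
  exists2 G, J G & forall n (X : ncball Q n), G n X = \sum_(k < m)
    (r%:C)%C ^+ k *: peval (val X) (series_part (taylor_coef F) k).
Proof.
move=> FV; pose p : ncpoly R d :=
  \sum_(k < m) (r%:C)%C ^+ k *: series_part (taylor_coef F) k.
have : Jpoly p.
  apply: (ideal_sum Jpoly_ideal) => k _; apply: (ideal_scale Jpoly_ideal).
  exact: vanishing_parts.
case=> G JG Gp; exists G => // n X; rewrite Gp /p peval_sum.
by apply: eq_bigr => k _; rewrite pevalZ.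
Qed.

End Ideals.

Lemma l2norm_mxactD (R : realType) n (A B : 'M[Cplx R]_n) v :
  l2norm (mxact (A + B) v) <= l2norm (mxact A v) + l2norm (mxact B v).
Proof. by rewrite mxactD; exact: l2normD. Qed.

(** * Dilations and radial limits *)

Section Dilations.
Variables (R : realType) (d : nat) (HR HS : hilbertType R).
Variable Q : 'I_d -> {linear HR -> HS}.
Local Notation C := (Cplx R).
Local Notation coef p := (fun w => monalg.mcoeff w (p : ncpoly R d)).
Hypothesis Q_bounded : forall j, continuous (Q j).
Hypothesis Q_indep : lin_indep Q.

(** Bernoulli's inequality, which gives a rate linear in [1 - r]. *)
Lemma one_sub_exp_le (r : R) k : 0 <= r -> r <= 1 -> 1 - r ^+ k <= (1 - r) *+ k.
Proof.
move=> r0 r1; elim: k => [|k IH]; first by rewrite expr0 subrr mulr0n.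
have -> : 1 - r ^+ k.+1 = (1 - r) + r * (1 - r ^+ k) by rewrite exprS; ring.
rewrite mulrS lerD2l; apply: le_trans IH.
by rewrite ler_piMl// subr_ge0 exprn_ile1.
Qed.

(** Degree [k] contributes [1 - r ^+ k], at most [k] times [1 - r], times a polynomial bounded on
    the whole ball. *)
Lemma dilation_bound c m : exists2 B : R, 0 <= B &
  forall n (X : ncball Q n) (r : R) v, 0 <= r -> r <= 1 ->
    l2norm (mxact (\sum_(k < m) peval (val X) (series_part c k) -
      \sum_(k < m) (r%:C)%C ^+ k *: peval (val X) (series_part c k)) v) <=
    (1 - r) * B * l2norm v.
Proof.
elim: m => [|m [B B0 HB]].
  exists 0 => // n X r v r0 r1; rewrite !big_ord0 subrr mxact0 l2norm0.
  by rewrite mulr0 mul0r.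
have [B' B'0 HB'] := poly_bounded Q_indep (series_part c m).
exists (B + B' *+ m); first by rewrite addr_ge0// mulrn_wge0.
move=> n X r v r0 r1; rewrite !big_ord_recr /=.
set S := \sum_(k < m) _; set T := \sum_(k < m) _; set P := peval _ _.
have -> : S + P - (T + (r%:C)%C ^+ m *: P) =
    (S - T) + ((1 - r ^+ m)%:C)%C *: P.
  by rewrite opprD addrACA rmorphB rmorph1 rmorphXn scalerBl scale1r.
apply: le_trans (l2norm_mxactD _ _ _) _.
rewrite mulrDr mulrDl lerD//; first exact: HB.
have rm : 0 <= 1 - r ^+ m by rewrite subr_ge0 exprn_ile1.
rewrite mxactZ l2normZ rnorm_real//.
apply: (@le_trans _ _ ((1 - r) *+ m * (B' * l2norm v))).
  by apply: ler_pM => //; [exact: l2norm_ge0|exact: one_sub_exp_le|exact: HB'].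
by rewrite mulrA mulrnAl mulrnAr.
Qed.

(** Cut off at an order [N] valid for all dilates of [X] at once; what is left is a polynomial.
    Since [N] depends on [X], so does [delta]. *)
Lemma radial_limit (F : Hinf Q) n (X : ncball Q n) (eps : R) : 0 < eps ->
  exists2 delta : R, 0 < delta & forall r (r0 : 0 <= r) (r1 : r <= 1) v,
    1 - r <= delta ->
    l2norm (mxact (F n X - F n (bscale X r0 r1)) v) <= eps * l2norm v.
Proof.
move=> eps0; have eps3 : 0 < eps / 3 by rewrite divr_gt0.
have [N _ /(_ _ (leqnn N)) H] := taylor_eventually_scale Q_bounded F X eps3.
have [B B0 HB] := dilation_bound (taylor_coef F) N.
have B1 : 0 < B + 1 by rewrite ltr_wpDl.
exists (eps / 3 / (B + 1)); first by rewrite divr_gt0.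
move=> r r0 r1 v rd.
set S := \sum_(k < N)
  (r%:C)%C ^+ k *: peval (val X) (series_part (taylor_coef F) k).
pose T := \sum_(k < N) peval (val X) (series_part (taylor_coef F) k).
have HT : l2norm (mxact (F n X - T) v) <= eps / 3 * l2norm v.
  have := H _ ler01 (lexx 1) v; rewrite heval_bscale1.
  by under eq_bigr => k _ do rewrite rmorph1 expr1n scale1r.
have HS' := H _ r0 r1 v.
have -> : F n X - F n (bscale X r0 r1) =
    (F n X - T) + (T - S) + (-1) *: (F n (bscale X r0 r1) - S).
  by rewrite scaleN1r opprB !subrKA.
apply: le_trans (l2norm_mxactD _ _ _) _.
rewrite mxactZ l2normZ rnormN1 mul1r.
apply: le_trans (lerD (l2norm_mxactD _ _ _) HS') _.
have -> : eps * l2norm v = eps / 3 * l2norm v + eps / 3 * l2norm v +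
  eps / 3 * l2norm v by field.
rewrite lerD2r; apply: lerD => //.
apply: le_trans (HB n X r v r0 r1) _; apply: ler_wpM2r; first exact: l2norm_ge0.
apply: (@le_trans _ _ ((1 - r) * (B + 1))).
  by rewrite ler_wpM2l ?subr_ge0// lerDl.
by rewrite -ler_pdivlMr.
Qed.

End Dilations.

(** * Approximation and closures *)

Section Closures.
Variables (R : realType) (d : nat) (HR HS : hilbertType R).
Variable Q : 'I_d -> {linear HR -> HS}.
Local Notation C := (Cplx R).
Local Notation coef p := (fun w => monalg.mcoeff w (p : ncpoly R d)).

Lemma hinf_ballP (F G : Hinf Q) (eps : R) : 0 < eps ->
  ball F (eps%:C)%C G ->
  forall n (X : ncball Q n) v,
    l2norm (mxact (F n X - G n X) v) <= eps * l2norm v.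
Proof.
move=> eps0; rewrite -ball_normE /= -[X in X < _]/(hnorm (F - G)) ltcR.
move=> FG n X v.
rewrite -heval_BE; apply: le_trans (supnormP _ _ _) _.
by rewrite ler_wpM2r ?l2norm_ge0// ltW.
Qed.

Lemma closure_hinfP (J : set (Hinf Q)) (F : Hinf Q) :
  closure J F <-> forall eps : R, 0 < eps -> exists2 G, J G &
    forall n (X : ncball Q n) v,
      l2norm (mxact (F n X - G n X) v) <= eps * l2norm v.
Proof.
split=> [JF eps eps0|H B /nbhs_ballP[[e e']]].
  have epsC : (0 : C) < (eps%:C)%C by rewrite ltcR.
  have [G [JG FG]] := JF _ (nbhsx_ballx F _ epsC).
  by exists G => //; exact: hinf_ballP.
rewrite /= ltcE /= => /andP[/eqP -> e0] FB.
have e2 : 0 < e / 2 by rewrite divr_gt0.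
have [G JG FG] := H _ e2; exists G; split=> //; apply: FB.
rewrite -ball_normE /= -[X in X < _]/(hnorm (F - G)) ltcR.
apply: (@le_lt_trans _ _ (e / 2)).
  by apply: fine_supnorm_le => [|n X v]; rewrite ?(ltW e2)// heval_BE.
by rewrite ltr_pdivrMr// ltr_pMr// ltr1n.
Qed.

Lemma eq0_of_l2norm n (B : 'M[C]_n) :
  (forall eps : R, 0 < eps -> forall v, l2norm (mxact B v) <= eps * l2norm v) ->
  B = 0.
Proof.
move=> H; apply: entry_small => eps eps0.
by apply: mxnorm_bound_entry; exact: H.
Qed.

Lemma closure_vanishing (J : set (Hinf Q)) (F : Hinf Q) n (X : ncball Q n) :
  closure J F -> zeros J X -> F n X = 0.
Proof.
move=> /closure_hinfP JF JX; apply: eq0_of_l2norm => eps eps0 v.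
by have [G JG /(_ n X v)] := JF _ eps0; rewrite (JX G JG) subr0.
Qed.

Lemma mxact_neq0 n (B : 'M[C]_n) : B <> 0 ->
  exists2 v, l2norm v <= 1 & 0 < l2norm (mxact B v).
Proof.
move=> B0; apply: contrapT => H; apply: B0; apply: eq0_of_l2norm => eps eps0 v.
have /mxnorm_leP/(_ v) : (mxnorm B <= 0%:E)%E.
  apply: ge_ereal_sup => _ [w /= w1 <-]; rewrite lee_fin leNgt.
  by apply/negP => w0; apply: H; exists w.
rewrite mul0r => /(_ (lexx 0))/le_trans; apply.
by rewrite mulr_ge0 ?l2norm_ge0 ?ltW.
Qed.

(** The functions that do not vanish at [X] form a bounded-pointwise open set disjoint from [J]: a
    function closer to [G] at [X] than the norm of [G(X) v] cannot vanish there. *)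
Lemma bp_closure_vanishing (J : set (Hinf Q)) (F : Hinf Q) n (X : ncball Q n) :
  bp_closure J F -> zeros J X -> F n X = 0.
Proof.
move=> JF JX; apply: contrapT => FX0.
pose U := [set G : Hinf Q | G n X <> 0].
have oU : open (U : set (Hinf_bp Q)).
  rewrite bp_openE => G Phi PF bPhi cPhi /mxact_neq0[v v1 Gv].
  apply: filterS (cPhi n X _ Gv) => K; rewrite /mkset => KG K0; move: KG.
  rewrite K0 sub0r ltNge => /negP; apply; apply: ereal_sup_ubound.
  exists v => //.
  by rewrite -scaleN1r mxactZ l2normZ rnormN1 mul1r.
have [G [JG GU]] := JF U (open_nbhs_nbhs (conj oU FX0)).
by apply: GU; exact: JX.
Qed.

Hypothesis Q_bounded : forall j, continuous (Q j).
Hypothesis Q_indep : lin_indep Q.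

Lemma poly_adisc (F : Hinf Q) p : is_poly F p -> Adisc Q F.
Proof. by move=> Fp; apply: subset_closure; exists p. Qed.

(** The witness is a Taylor sum of [F(r X)]: these sums lie in [J], and for fixed [r < 1] they
    converge uniformly on the ball. *)
Lemma approx_dilation (J : set (Hinf Q)) A (F : Hinf Q) (r eps : R)
    (r0 : 0 < r) (r1 : r < 1) :
  (forall G p, is_poly G p -> A G) ->
  two_sided_ideal A J -> homogeneous J ->
  (forall n X, zeros J X -> F n X = 0) -> 0 < eps ->
  exists2 G : Hinf Q, J G & forall n (X : ncball Q n) v,
    l2norm (mxact (F n (bscale X (ltW r0) (ltW r1)) - G n X) v) <=
    eps * l2norm v.
Proof.
move=> A_poly J_ideal J_homog FV eps0.
(* The largest [e] allowed by [r ^+ 2 + e ^+ 2 <= 1]. *)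
pose e := Num.sqrt (1 - r ^+ 2).
have r21 : r ^+ 2 < 1 by rewrite expr_lt1// ltW.
have e2 : e ^+ 2 = 1 - r ^+ 2 by rewrite sqr_sqrtr// subr_ge0 ltW.
have e0 : 0 < e by rewrite sqrtr_gt0 subr_gt0.
have re : r ^+ 2 + e ^+ 2 <= 1 by rewrite e2 addrC subrK.
have [N _ /(_ _ (leqnSn N)) HN] :=
  exp_small (fine (supnorm (hval F)) / e) (ltW r0) r1 eps0.
have [G JG GE] := dilated_partial_sum Q_bounded Q_indep A_poly J_ideal J_homog
  r N.+1 FV.
exists G => // n X v; rewrite GE.
apply: le_trans (taylor_remainder_scale Q_bounded F X N r0 (ltW r1) v e0 re) _.
by rewrite ler_wpM2r ?l2norm_ge0// mulrAC.
Qed.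

(** A polynomial [P] near [F] controls the passage from [X] to [r X] uniformly. The error splits
    into [F - P] at [X], [P(X) - P(r X)], [P - F] at [r X], and [F(r X) - G(X)]. *)
Lemma adisc_vanishing_closure (J : set (Hinf Q)) (F : Hinf Q) :
  two_sided_ideal (Adisc Q) J -> homogeneous J ->
  Adisc Q F -> (forall n X, zeros J X -> F n X = 0) -> closure J F.
Proof.
move=> J_ideal J_homog /closure_hinfP AF FV; apply/closure_hinfP => eps eps0.
have eps4 : 0 < eps / 4 by rewrite divr_gt0.
have [P [p Pp] FP] := AF _ eps4.
have [B B0 HB] := dilation_bound Q_indep (coef p) (deg_bound p).+1.
have B1 : 0 < B + 1 by rewrite ltr_wpDl.
(* [x] is [1 - r]: at most [1/2] to keep [r] positive, and small against the dilation bound [B] of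
   [P]. *)
pose x := Num.min 2^-1 (eps / 4 / (B + 1)).
have x0 : 0 < x by rewrite lt_min invr_gt0 ltr0n /= divr_gt0.
have x1 : x < 1 by rewrite gt_min invf_lt1// ltr1n.
have xB : x * (B + 1) <= eps / 4 by rewrite -ler_pdivlMr// ge_min lexx orbT.
have r0 : 0 < 1 - x by rewrite subr_gt0.
have r1 : 1 - x < 1 by rewrite ltrBlDr ltrDl.
have [G JG FG] := approx_dilation r0 r1 poly_adisc J_ideal J_homog FV eps4.
exists G => // n X v; set Y := bscale X (ltW r0) (ltW r1).
have PX : P n X =
    \sum_(k < (deg_bound p).+1) peval (val X) (series_part (coef p) k).
  by rewrite Pp -peval_sum -/(trunc _ p) trunc_deg_bound.
have PY : P n Y = \sum_(k < (deg_bound p).+1)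
    ((1 - x)%:C)%C ^+ k *: peval (val X) (series_part (coef p) k).
  rewrite Pp val_bscale -[in LHS](trunc_deg_bound (leqnn (deg_bound p))) /trunc.
  by rewrite peval_sum; apply: eq_bigr => k _; rewrite peval_scale.
have -> : F n X - G n X = (F n X - P n X) + (P n X - P n Y) +
    ((-1) *: (F n Y - P n Y) + (F n Y - G n X)).
  by rewrite scaleN1r opprB !subrKA.
have -> : eps * l2norm v = (eps / 4 * l2norm v + eps / 4 * l2norm v) +
  (eps / 4 * l2norm v + eps / 4 * l2norm v) by field.
apply: le_trans (l2norm_mxactD _ _ _) _; apply: lerD.
  apply: le_trans (l2norm_mxactD _ _ _) _; apply: lerD; first exact: FP.
  rewrite PX PY; apply: le_trans (HB n X _ v (ltW r0) (ltW r1)) _.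
  rewrite ler_wpM2r ?l2norm_ge0// subKr; apply: le_trans xB.
  by rewrite ler_pM2l// lerDl.
apply: le_trans (l2norm_mxactD _ _ _) _; apply: lerD; last exact: FG.
by rewrite mxactZ l2normZ rnormN1 mul1r; exact: FP.
Qed.

(** The sequence [G N] in [J] follows the dilates of [F] within [1 / (N + 1)]. It is bounded by the
    norm of [F] plus [1], and [radial_limit] gives its convergence at each point. *)
Lemma hinf_vanishing_closure (J : set (Hinf Q)) (F : Hinf Q) :
  two_sided_ideal setT J -> homogeneous J ->
  (forall n X, zeros J X -> F n X = 0) -> bp_closure J F.
Proof.
move=> J_ideal J_homog FV.
(* The shift by [2] keeps [r N] positive at [N = 0]. *)
pose r N : R := 1 - N.+2%:R^-1.
have r0 N : 0 < r N by rewrite subr_gt0 invf_lt1 ?ltr0n// ltr1n.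
have r1 N : r N < 1 by rewrite ltrBlDr ltrDl invr_gt0 ltr0n.
have G_ex N : exists2 G : Hinf Q, J G & forall n (X : ncball Q n) v,
    l2norm (mxact (F n (bscale X (ltW (r0 N)) (ltW (r1 N))) - G n X) v) <=
    N.+1%:R^-1 * l2norm v.
  by apply: (approx_dilation _ _ _ J_ideal) => //; rewrite invr_gt0 ltr0n.
pose G N := sval (cid2 (G_ex N)).
have JG N : J (G N) by rewrite /G; case: cid2.
have FG N n (X : ncball Q n) v :
    l2norm (mxact (F n (bscale X (ltW (r0 N)) (ltW (r1 N))) - G N n X) v) <=
    N.+1%:R^-1 * l2norm v by rewrite /G; case: cid2.
have inv_small (eps : R) : 0 < eps -> \forall N \near \oo, N.+1%:R^-1 <= eps.
  move=> eps0; near do apply: ltW.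
  exact: near_infty_natSinv_lt (PosNum eps0).
have cG : (G @ \oo : set_system (Hinf_bp Q)) --> (F : Hinf_bp Q).
  apply/bp_cvgP.
    exists (fine (supnorm (hval F)) + 1).
    rewrite -[_ _]/(\forall N \near \oo,
      (supnorm (hval (G N)) <= (fine (supnorm (hval F)) + 1)%:E)%E).
    apply: nearW => N; apply/supnorm_leP.
      by rewrite addr_ge0 ?fine_supnorm_ge0.
    move=> n X v.
    rewrite -[X in l2norm (mxact X _)]/(G N n X).
    set Y := bscale X (ltW (r0 N)) (ltW (r1 N)).
    have -> : G N n X = F n Y + (-1) *: (F n Y - G N n X).
      by rewrite scaleN1r opprB addrC subrK.
    apply: le_trans (l2norm_mxactD _ _ _) _; rewrite mulrDl lerD ?supnormP//.
    rewrite mxactZ l2normZ rnormN1 !mul1r.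
    apply: le_trans (FG _ _ _ _) _; rewrite ler_piMl ?l2norm_ge0//.
    by rewrite invf_le1// ler1n.
  move=> n X e e0; have e4 : 0 < e / 4 by rewrite divr_gt0.
  have [delta delta0 H] := radial_limit Q_bounded Q_indep F X e4.
  rewrite -[_ _]/(\forall N \near \oo, (mxnorm (G N n X - F n X) < e%:E)%E).
  near=> N; apply: (@le_lt_trans _ _ (e / 2)%:E); last first.
    by rewrite lte_fin ltr_pdivrMr// ltr_pMr// ltr1n.
  apply/mxnorm_leP => [|v]; first by rewrite divr_ge0 ?ltW.
  set Y := bscale X (ltW (r0 N)) (ltW (r1 N)).
  have -> : G N n X - F n X = (-1) *: ((F n X - F n Y) + (F n Y - G N n X)).
    by rewrite subrKA scaleN1r opprB.
  rewrite mxactZ l2normZ rnormN1 mul1r.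
  have -> : e / 2 * l2norm v = e / 4 * l2norm v + e / 4 * l2norm v by field.
  apply: le_trans (l2norm_mxactD _ _ _) _; apply: lerD.
    apply: H; rewrite /r subKr; apply: (@le_trans _ _ N.+1%:R^-1).
      by rewrite lef_pV2 ?posrE ?ltr0n// ler_nat.
    by near: N; exact: inv_small.
  apply: le_trans (FG _ _ _ _) _; apply: ler_wpM2r; first exact: l2norm_ge0.
  by near: N; exact: inv_small.
move=> B /cG[N _ /(_ N (leqnn N)) BG].
by exists (G N); split.
Unshelve. all: by end_near. Qed.

End Closures.

Unset Implicit Arguments.

(** [Q_bounded] makes the linear maps [Q j] bounded operators. The norm closure inside [Adisc Q] is
    the closure in [Hinf Q] cut down to [Adisc Q]. *)
Theorem theorem4p3 (R : realType) (d : nat) (HR HS : hilbertType R)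
    (Q : 'I_d -> {linear HR -> HS})
    (Q_bounded : forall j, continuous (Q j))
    (Q_indep : lin_indep Q) :
  (forall J : set (ncpoly R d),
     two_sided_ideal setT J -> homogeneous_poly J ->
     vanishing_poly (zeros_poly Q J) = J) /\
  (forall J : set (Hinf Q),
     two_sided_ideal (Adisc Q) J -> homogeneous J ->
     vanishing (Adisc Q) (zeros J) = closure J `&` Adisc Q) /\
  (forall J : set (Hinf Q),
     two_sided_ideal setT J -> homogeneous J ->
     vanishing setT (zeros J) = bp_closure J).
Proof.
split; first exact: poly_nullstellensatz.
split=> J J_ideal J_homog; apply/seteqP; split.
- by move=> F [AF FV]; split=> //; exact: adisc_vanishing_closure.
- by move=> F [JF AF]; split=> // n X; exact: closure_vanishing.
- by move=> F [_ FV]; exact: hinf_vanishing_closure.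
- by move=> F JF; split=> // n X; exact: bp_closure_vanishing.
Qed.
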